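(* Let $(u,v,T_{11},T_{12},T_{22},\rho)$ be a local analytic solution in space-time of the balance laws $$\partial_1(\rho u^2-T_{11})+\partial_2(\rho uv-T_{12})=-\partial_t(\rho u),\qquad \partial_1(\rho uv-T_{12})+\partial_2(\rho v^2-T_{22})=-\partial_t(\rho v),$$ $$\partial_1(\rho u)+\partial_2(\rho v)=-\partial_t\rho,$$ such that, at least on some initial time interval, $$T_{11}T_{22}-T_{12}^2+2\rho uvT_{12}-\rho v^2T_{11}-\rho u^2T_{22}>0,$$ and satisfying the condition $$T_{12}-\rho uv\neq0\quad\text{at a point }\mathbf x^0 .$$ Then there is an evolving metric $\mathbf g$ (locally near $\mathbf x^0$) so that the continuum mechanical solution defines a time evolving two-dimensional Riemannian manifold $(\mathcal M,\mathbf g)$ isometrically immersed in $\mathbb R^3$.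
   Context: $\mathbf T=(T_{11},T_{12},T_{22})$ is the symmetric Cauchy stress tensor, $(u,v)$ the velocity and $\rho$ the mass density. ''The continuum mechanical solution defines a time evolving Riemannian manifold $(\mathcal M,\mathbf g)$ isometrically immersed in $\mathbb R^3$'' means that $$L=\rho v^2-T_{22},\qquad M=-\rho uv+T_{12},\qquad N=\rho u^2-T_{11}$$ satisfy at each time the Gauss–Codazzi equations $$\partial_1N-\partial_2M=-\Gamma^1_{22}L+2\Gamma^1_{12}M-\Gamma^1_{11}N,\quad \partial_1M-\partial_2L=\Gamma^2_{22}L-2\Gamma^2_{12}M+\Gamma^2_{11}N,\quad LN-M^2=\kappa,$$ where $\Gamma^k_{ij}$ and $\kappa$ are the Christoffel symbols and Gauss curvature of $\mathbf g(\cdot,t)$; equivalently there is locally an immersion $\mathbf y(t,\cdot)$ into $\mathbb R^3$ with $\partial_i\mathbf y\cdot\partial_j\mathbf y=g_{ij}$ and second fundamental form divided by $\sqrt{\det\mathbf g}$ equal to $(L,M,N)$. *)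

(* Defs.v *)
From Stdlib Require Import Reals.
From Coquelicot Require Import Coquelicot.

Set Implicit Arguments.
Unset Strict Implicit.
Unset Printing Implicit Defensive.

Open Scope R_scope.

(* Space-time points are triples (t, x1, x2). *)
Definition field := R * R * R -> R.

Inductive idx := X1 | X2.

Definition sum_idx (F : idx -> R) : R := F X1 + F X2.

Definition Dt (f : field) : field :=
  fun p => let '(t, x1, x2) := p in Derive (fun s => f (s, x1, x2)) t.

Definition D (i : idx) (f : field) : field :=
  fun p => let '(t, x1, x2) := p in
  match i with
  | X1 => Derive (fun s => f (t, s, x2)) x1
  | X2 => Derive (fun s => f (t, x1, s)) x2
  end.

Definition partially_derivable (f : field) (p : R * R * R) : Prop :=
  let '(t, x1, x2) := p in
  ex_derive (fun s => f (s, x1, x2)) t /\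
  ex_derive (fun s => f (t, s, x2)) x1 /\
  ex_derive (fun s => f (t, x1, s)) x2.

(* The sum of the c i j k over all i + j + k = n. *)
Definition sum_degree (c : nat -> nat -> nat -> R) (n : nat) : R :=
  sum_n (fun i => sum_n (fun j => c i j (n - i - j)%nat) (n - i)) n.

(* Real analyticity: near p, f is the sum of an absolutely convergent power
   series in three variables.  Grouping the terms by total degree is harmless
   because absolute convergence of the whole multiple series is required. *)
Definition analytic_at (f : field) (p : R * R * R) : Prop :=
  let '(t, x1, x2) := p in
  exists (a : nat -> nat -> nat -> R) (r : posreal),
    forall s y1 y2 : R, Rabs s < r -> Rabs y1 < r -> Rabs y2 < r ->
      let term i j k := a i j k * s ^ i * y1 ^ j * y2 ^ k in
      ex_series (sum_degree (fun i j k => Rabs (term i j k))) /\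
      is_series (sum_degree term) (f (t + s, x1 + y1, x2 + y2)).

Definition analytic_on (U : R * R * R -> Prop) (f : field) : Prop :=
  forall p, U p -> analytic_at f p.

(* Meaningful for open U. *)
Fixpoint Ck_on (n : nat) (U : R * R * R -> Prop) (f : field) : Prop :=
  (forall p, U p -> continuous f p) /\
  match n with
  | O => True
  | S m =>
      (forall p, U p -> partially_derivable f p) /\
      Ck_on m U (Dt f) /\ forall i, Ck_on m U (D i f)
  end.

Definition smooth_on (U : R * R * R -> Prop) (f : field) : Prop :=
  forall n, Ck_on n U f.

Definition balance_laws (U : R * R * R -> Prop)
    (u v T11 T12 T22 rho : field) : Prop :=
  forall p, U p ->
    D X1 (fun q => rho q * u q ^ 2 - T11 q) p
      + D X2 (fun q => rho q * u q * v q - T12 q) p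
      = - Dt (fun q => rho q * u q) p /\
    D X1 (fun q => rho q * u q * v q - T12 q) p
      + D X2 (fun q => rho q * v q ^ 2 - T22 q) p
      = - Dt (fun q => rho q * v q) p /\
    D X1 (fun q => rho q * u q) p + D X2 (fun q => rho q * v q) p
      = - Dt rho p.

(* A time-dependent field of 2 x 2 matrices g_ij. *)
Definition tensor2 := idx -> idx -> field.

(* A Riemannian metric on each time slice of U, smooth jointly in time and
   space. *)
Definition evolving_metric (U : R * R * R -> Prop) (g : tensor2) : Prop :=
  (forall i j, smooth_on U (g i j)) /\
  (forall p, U p ->
     (forall i j, g i j p = g j i p) /\
     (forall xi : idx -> R, (exists i, xi i <> 0) ->
        0 < sum_idx (fun i => sum_idx (fun j => g i j p * xi i * xi j)))).

Definition metric_det (g : tensor2) : field :=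
  fun p => g X1 X1 p * g X2 X2 p - g X1 X2 p * g X2 X1 p.

(* The entries g^{kl} of the inverse matrix. *)
Definition metric_inv (g : tensor2) : tensor2 :=
  fun k l p =>
  match k, l with
  | X1, X1 => g X2 X2 p / metric_det g p
  | X1, X2 => - g X1 X2 p / metric_det g p
  | X2, X1 => - g X2 X1 p / metric_det g p
  | X2, X2 => g X1 X1 p / metric_det g p
  end.

(* christoffel g k i j is Gamma^k_{ij}. *)
Definition christoffel (g : tensor2) (k i j : idx) : field :=
  fun p => / 2 * sum_idx (fun l => metric_inv g k l p *
    (D i (g j l) p + D j (g i l) p - D l (g i j) p)).

(* riemann g l i j k is the l-th component of R(d_i, d_j) d_k, with
   R(X, Y) = [nabla_X, nabla_Y] - nabla_[X, Y]. *)
Definition riemann (g : tensor2) (l i j k : idx) : field :=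
  fun p => D i (christoffel g l j k) p - D j (christoffel g l i k) p
    + sum_idx (fun m => christoffel g m j k p * christoffel g l i m p
                      - christoffel g m i k p * christoffel g l j m p).

(* <R(d_1, d_2) d_2, d_1> / det g; this sign makes round spheres positive. *)
Definition gauss_curvature (g : tensor2) : field :=
  fun p => sum_idx (fun l => g X1 l p * riemann g l X1 X2 X2 p)
           / metric_det g p.

(* L, M, N are the coefficients of the second fundamental form divided by
   sqrt (det g). *)
Definition gauss_codazzi (U : R * R * R -> Prop) (g : tensor2)
    (L M N : field) : Prop :=
  let Gamma := christoffel g in
  forall p, U p ->
    D X1 N p - D X2 M p
      = - Gamma X1 X2 X2 p * L p + 2 * Gamma X1 X1 X2 p * M p
        - Gamma X1 X1 X1 p * N p /\
    D X1 M p - D X2 L p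
      = Gamma X2 X2 X2 p * L p - 2 * Gamma X2 X1 X2 p * M p
        + Gamma X2 X1 X1 p * N p /\
    L p * N p - M p ^ 2 = gauss_curvature g p.

(* Main.v *)
(* The Codazzi equations, with lowered Christoffel symbols, are linear in the
   metric (E, F, G) and its first derivatives.  Since L N - M^2 > 0 forces
   N <> 0, they determine d_1 E and d_1 F; the Gauss equation then determines
   d_1^2 G.  In the unknowns E, F, G, d_1 G, d_2 G, d_2 E, d_2 F and
   1 / (E G - F^2) this is a system d_1 w = P(w) + d_2 Q(w) with polynomial P, Q
   whose coefficients are analytic in (t, x1, x2).  The Cauchy-Kovalevskaya
   theorem, with t as a parameter and the Euclidean metric prescribed on
   x1 = x01, provides an analytic solution.  Formal solutions are constructed on
   the level of jets, bounded by majorants, and then summed. *)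

(* The estimates must survive the loss of one derivative in the term d_2 Q. The majorants therefore
   give x1 a weight [b] of its own, while t and x2 keep the weight [a] of the data: integration in
   x1 gains 1 / b, the bounds on [P] and [Q] do not depend on [b], and a large [b] closes the
   iteration. The profile [phi], with Taylor coefficients 1 / (n + 1)^2, is stable under products up
   to the factor 8 whatever the weights, so that polynomial nonlinearities cost only constants. The
   system is of first order because the term d_2^2 E of the Gauss equation cancels once d_1 F has
   its Codazzi value. The unknowns R, S, M start out unrelated to d_2 G, d_2 E, d_2 F; these
   relations, and Delta det g = 1, hold on x1 = x01 and are propagated by uniqueness in x1. Jets
   record derivatives rather than Taylor coefficients and form a differential ring under plain
   equality. The geometry thus reduces to ring identities, and analysis enters only in bounding jets
   and in passing between jets and functions. *)
Require Import Defs.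
From Stdlib Require Import Reals Factorial Lra Lia List FunctionalExtensionality.
From Coquelicot Require Import Coquelicot.
Open Scope R_scope.

(* The entry [c i j k] stands for the derivative d_t^i d_1^j d_2^k at the base
   point, so that partial derivatives act on jets as shifts. *)
Definition jet := nat -> nat -> nat -> R.

Definition jdt (c : jet) : jet := fun i j k => c (S i) j k.
Definition jd1 (c : jet) : jet := fun i j k => c i (S j) k.
Definition jd2 (c : jet) : jet := fun i j k => c i j (S k).

(** * The differential ring of jets *)

Definition jconst (r : R) : jet := fun i j k =>
  match i, j, k with O, O, O => r | _, _, _ => 0 end.
Definition jadd (c d : jet) : jet := fun i j k => c i j k + d i j k.
Definition jopp (c : jet) : jet := fun i j k => - c i j k.
Definition jsub (c d : jet) : jet := fun i j k => c i j k - d i j k.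

(** The recursion is Leibniz's rule itself instead of a sum with binomial coefficients, so that the
    product is a bilinear operation on which derivatives act by computation. *)
Fixpoint leibniz (a b : nat -> R) (n : nat) : R :=
  match n with
  | O => a O * b O
  | S m => leibniz (fun k => a (S k)) b m + leibniz a (fun k => b (S k)) m
  end.

Fixpoint leibniz2 (c d : nat -> nat -> R) (j : nat) : nat -> R :=
  match j with
  | O => leibniz (c O) (d O)
  | S m => fun k => leibniz2 (fun l => c (S l)) d m k
                    + leibniz2 c (fun l => d (S l)) m k
  end.

Fixpoint leibniz3 (c d : jet) (i : nat) : nat -> nat -> R :=
  match i with
  | O => leibniz2 (c O) (d O)
  | S m => fun j k => leibniz3 (jdt c) d m j k + leibniz3 c (jdt d) m j k
  end.

Definition jmul (c d : jet) : jet := leibniz3 c d.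

Lemma jmul_0 c d : jmul c d O O O = c O O O * d O O O.
Proof. reflexivity. Qed.

Lemma jmul_St c d i j k :
  jmul c d (S i) j k = jmul (jdt c) d i j k + jmul c (jdt d) i j k.
Proof. reflexivity. Qed.

(** The product peels off t-derivatives first. The rule for t is therefore definitional, while those
    for x1 and x2 have to be commuted past the earlier derivatives. *)
Lemma jmul_S1 c d i j k :
  jmul c d i (S j) k = jmul (jd1 c) d i j k + jmul c (jd1 d) i j k.
Proof.
  revert c d; induction i as [|i IH]; intros c d; [reflexivity|].
  rewrite !jmul_St, !IH; change (jdt (jd1 c)) with (jd1 (jdt c));
  change (jdt (jd1 d)) with (jd1 (jdt d)); ring.
Qed.

Lemma leibniz2_S2 c d j k :
  leibniz2 c d j (S k) = leibniz2 (fun j k => c j (S k)) d j k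
                         + leibniz2 c (fun j k => d j (S k)) j k.
Proof.
  revert c d; induction j as [|j IH]; intros c d; [reflexivity|].
  simpl; rewrite !IH; ring.
Qed.

Lemma jmul_S2 c d i j k :
  jmul c d i j (S k) = jmul (jd2 c) d i j k + jmul c (jd2 d) i j k.
Proof.
  revert c d; induction i as [|i IH]; intros c d.
  - exact (leibniz2_S2 _ _ j k).
  - rewrite !jmul_St, !IH; change (jdt (jd2 c)) with (jd2 (jdt c));
    change (jdt (jd2 d)) with (jd2 (jdt d)); ring.
Qed.

(** Meant for identities between jets: they are checked at the base point and after each derivative.
    The statements are quantified over all jets, since differentiating a product changes its
    factors. *)
Lemma jet_ind (P : nat -> nat -> nat -> Prop) :
  P O O O ->
  (forall i j k, P i j k -> P (S i) j k) ->
  (forall i j k, P i j k -> P i (S j) k) ->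
  (forall i j k, P i j k -> P i j (S k)) ->
  forall i j k, P i j k.
Proof.
  intros H0 Ht H1 H2 i j k.
  induction i as [|i IH]; [|auto].
  induction j as [|j IH]; [|auto].
  induction k as [|k IH]; auto.
Qed.

(** Extensionality makes jets a ring for plain equality, so that [ring] and rewriting apply to
    them. *)
Lemma jet_ext (c d : jet) : (forall i j k, c i j k = d i j k) -> c = d.
Proof.
  intros H; do 3 (apply functional_extensionality; intro); apply H.
Qed.

Lemma jd_mul c d :
  jdt (jmul c d) = jadd (jmul (jdt c) d) (jmul c (jdt d)) /\
  jd1 (jmul c d) = jadd (jmul (jd1 c) d) (jmul c (jd1 d)) /\
  jd2 (jmul c d) = jadd (jmul (jd2 c) d) (jmul c (jd2 d)).
Proof.
  split; [|split]; apply jet_ext; intros; unfold jadd.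
  - exact (jmul_St c d i j k).
  - exact (jmul_S1 c d i j k).
  - exact (jmul_S2 c d i j k).
Qed.

Lemma jd_const r :
  jdt (jconst r) = jconst 0 /\ jd1 (jconst r) = jconst 0 /\
  jd2 (jconst r) = jconst 0.
Proof.
  split; [|split]; apply jet_ext; intros [|i] [|j] [|k]; reflexivity.
Qed.

Lemma jmul_comm c d : jmul c d = jmul d c.
Proof.
  apply jet_ext; intros i j k; revert c d.
  apply (jet_ind (fun i j k => forall c d, jmul c d i j k = jmul d c i j k));
    clear i j k.
  - intros; rewrite !jmul_0; ring.
  - intros i j k IH c d; rewrite !jmul_St, (IH _ d), (IH c); ring.
  - intros i j k IH c d; rewrite !jmul_S1, (IH _ d), (IH c); ring.
  - intros i j k IH c d; rewrite !jmul_S2, (IH _ d), (IH c); ring.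
Qed.

Lemma jmul_addl c d e : jmul (jadd c d) e = jadd (jmul c e) (jmul d e).
Proof.
  apply jet_ext; intros i j k; revert c d e.
  apply (jet_ind (fun i j k => forall c d e, jmul (jadd c d) e i j k
    = jmul c e i j k + jmul d e i j k)); clear i j k.
  - intros; rewrite !jmul_0; unfold jadd; ring.
  - intros i j k IH c d e; rewrite !jmul_St.
    change (jdt (jadd c d)) with (jadd (jdt c) (jdt d)).
    rewrite !IH; unfold jadd; ring.
  - intros i j k IH c d e; rewrite !jmul_S1.
    change (jd1 (jadd c d)) with (jadd (jd1 c) (jd1 d)).
    rewrite !IH; unfold jadd; ring.
  - intros i j k IH c d e; rewrite !jmul_S2.
    change (jd2 (jadd c d)) with (jadd (jd2 c) (jd2 d)).
    rewrite !IH; unfold jadd; ring.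
Qed.

Lemma jmul_const_coef r c i j k : jmul (jconst r) c i j k = r * c i j k.
Proof.
  revert r c.
  apply (jet_ind (fun i j k => forall r c,
    jmul (jconst r) c i j k = r * c i j k)); clear i j k.
  - reflexivity.
  - intros i j k IH r c; rewrite jmul_St, (proj1 (jd_const r)), !IH.
    unfold jdt; ring.
  - intros i j k IH r c; rewrite jmul_S1, (proj1 (proj2 (jd_const r))), !IH.
    unfold jd1; ring.
  - intros i j k IH r c; rewrite jmul_S2, (proj2 (proj2 (jd_const r))), !IH.
    unfold jd2; ring.
Qed.

Lemma jmul_addr c d e : jmul c (jadd d e) = jadd (jmul c d) (jmul c e).
Proof. rewrite !(jmul_comm c); apply jmul_addl. Qed.

Lemma jmul_assoc c d e : jmul c (jmul d e) = jmul (jmul c d) e.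
Proof.
  apply jet_ext; intros i j k; revert c d e.
  apply (jet_ind (fun i j k => forall c d e,
    jmul c (jmul d e) i j k = jmul (jmul c d) e i j k)); clear i j k.
  - intros; rewrite !jmul_0; ring.
  - intros i j k IH c d e.
    rewrite !jmul_St, (proj1 (jd_mul d e)), (proj1 (jd_mul c d)).
    rewrite jmul_addl, jmul_addr; unfold jadd; rewrite !IH; ring.
  - intros i j k IH c d e.
    rewrite !jmul_S1, (proj1 (proj2 (jd_mul d e))),
      (proj1 (proj2 (jd_mul c d))).
    rewrite jmul_addl, jmul_addr; unfold jadd; rewrite !IH; ring.
  - intros i j k IH c d e.
    rewrite !jmul_S2, (proj2 (proj2 (jd_mul d e))),
      (proj2 (proj2 (jd_mul c d))).
    rewrite jmul_addl, jmul_addr; unfold jadd; rewrite !IH; ring.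
Qed.

Lemma jet_ring_theory :
  ring_theory (jconst 0) (jconst 1) jadd jmul jsub jopp eq.
Proof.
  constructor; intros.
  - apply jet_ext; intros [|i] [|j] [|k]; unfold jadd; simpl; ring.
  - apply jet_ext; intros; unfold jadd; ring.
  - apply jet_ext; intros; unfold jadd; ring.
  - apply jet_ext; intros; rewrite jmul_const_coef; ring.
  - apply jmul_comm.
  - apply jmul_assoc.
  - apply jmul_addl.
  - apply jet_ext; intros; unfold jadd, jsub, jopp; ring.
  - apply jet_ext; intros [|i] [|j] [|k]; unfold jadd, jopp; simpl; ring.
Qed.
Add Ring jet_ring : jet_ring_theory.

Declare Scope jet_scope.
Delimit Scope jet_scope with jet.
Bind Scope jet_scope with jet.
Infix "+" := jadd : jet_scope.
Infix "-" := jsub : jet_scope.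
Infix "*" := jmul : jet_scope.
Notation "- c" := (jopp c) : jet_scope.

(** * Majorants *)

Lemma leibniz_scal_l r a b n :
  leibniz (fun k => r * a k) b n = r * leibniz a b n.
Proof.
  revert a b; induction n as [|n IH]; intros a b; simpl; [ring|].
  rewrite (IH (fun k => a (S k))), (IH a); ring.
Qed.

Lemma leibniz_scal_r r a b n :
  leibniz a (fun k => r * b k) n = r * leibniz a b n.
Proof.
  revert a b; induction n as [|n IH]; intros a b; simpl; [ring|].
  rewrite (IH _ (fun k => b (S k))), (IH _ b); ring.
Qed.

(* The bound says that the jet is majorized by a function of the single variable
   a t + b x1 + a x2 with derivatives [A n] at 0. *)
Definition bounded_by (a b : R) (A : nat -> R) (c : jet) : Prop :=
  forall i j k, Rabs (c i j k) <= a ^ i * b ^ j * a ^ k * A (i + j + k)%nat.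

Lemma bounded_by_jdt a b A c :
  bounded_by a b A c -> bounded_by a b (fun n => a * A (S n)) (jdt c).
Proof.
  intros H i j k; unfold jdt.
  eapply Rle_trans; [apply H|]; right; simpl; ring.
Qed.

Lemma bounded_by_jd1 a b A c :
  bounded_by a b A c -> bounded_by a b (fun n => b * A (S n)) (jd1 c).
Proof.
  intros H i j k; unfold jd1.
  eapply Rle_trans; [apply H|]; right.
  replace (i + S j + k)%nat with (S (i + j + k)) by lia; simpl; ring.
Qed.

Lemma bounded_by_jd2 a b A c :
  bounded_by a b A c -> bounded_by a b (fun n => a * A (S n)) (jd2 c).
Proof.
  intros H i j k; unfold jd2.
  eapply Rle_trans; [apply H|]; right.
  replace (i + j + S k)%nat with (S (i + j + k)) by lia; simpl; ring.
Qed.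

Lemma bounded_by_mul a b A B c d :
  bounded_by a b A c -> bounded_by a b B d ->
  bounded_by a b (leibniz A B) (c * d)%jet.
Proof.
  intros Hc Hd i j k; revert A B c d Hc Hd.
  apply (jet_ind (fun i j k => forall A B c d,
    bounded_by a b A c -> bounded_by a b B d ->
    Rabs ((c * d)%jet i j k)
      <= a ^ i * b ^ j * a ^ k * leibniz A B (i + j + k)%nat));
    clear i j k.
  - intros A B c d Hc Hd; rewrite jmul_0, Rabs_mult; simpl.
    specialize (Hc O O O); specialize (Hd O O O); simpl in Hc, Hd.
    rewrite !Rmult_1_l in Hc, Hd |- *.
    apply Rmult_le_compat; auto using Rabs_pos.
  - intros i j k IH A B c d Hc Hd; rewrite jmul_St.
    eapply Rle_trans; [apply Rabs_triang|].
    pose proof (IH _ _ _ _ (bounded_by_jdt _ _ _ _ Hc) Hd) as H1.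
    pose proof (IH _ _ _ _ Hc (bounded_by_jdt _ _ _ _ Hd)) as H2.
    rewrite (leibniz_scal_l a (fun n => A (S n))) in H1.
    rewrite (leibniz_scal_r a _ (fun n => B (S n))) in H2.
    simpl; lra.
  - intros i j k IH A B c d Hc Hd; rewrite jmul_S1.
    eapply Rle_trans; [apply Rabs_triang|].
    pose proof (IH _ _ _ _ (bounded_by_jd1 _ _ _ _ Hc) Hd) as H1.
    pose proof (IH _ _ _ _ Hc (bounded_by_jd1 _ _ _ _ Hd)) as H2.
    rewrite (leibniz_scal_l b (fun n => A (S n))) in H1.
    rewrite (leibniz_scal_r b _ (fun n => B (S n))) in H2.
    replace (i + S j + k)%nat with (S (i + j + k)) by lia; simpl; lra.
  - intros i j k IH A B c d Hc Hd; rewrite jmul_S2.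
    eapply Rle_trans; [apply Rabs_triang|].
    pose proof (IH _ _ _ _ (bounded_by_jd2 _ _ _ _ Hc) Hd) as H1.
    pose proof (IH _ _ _ _ Hc (bounded_by_jd2 _ _ _ _ Hd)) as H2.
    rewrite (leibniz_scal_l a (fun n => A (S n))) in H1.
    rewrite (leibniz_scal_r a _ (fun n => B (S n))) in H2.
    replace (i + j + S k)%nat with (S (i + j + k)) by lia; simpl; lra.
Qed.

(** Divided by n!, the Leibniz product is the Cauchy product of Taylor coefficients. The induction
    splits the factor n + 1 as k + (n + 1 - k), one summand for each factor that is
    differentiated. *)
Lemma leibniz_fact (al be : nat -> R) n :
  leibniz (fun k => INR (fact k) * al k) (fun k => INR (fact k) * be k) n
  = INR (fact n) * sum_f_R0 (fun k => al k * be (n - k)%nat) n.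
Proof.
  revert al be; induction n as [|n IH]; intros al be; [simpl; ring|].
  assert (Hs : forall (u : nat -> R),
    (fun k => INR (fact (S k)) * u (S k))
    = (fun k => INR (fact k) * (INR (S k) * u (S k)))).
  { intros u; apply functional_extensionality; intro k.
    rewrite fact_simpl, mult_INR; ring. }
  change (leibniz (fun k => INR (fact (S k)) * al (S k))
      (fun k => INR (fact k) * be k) n
    + leibniz (fun k => INR (fact k) * al k)
      (fun k => INR (fact (S k)) * be (S k)) n
    = INR (fact (S n))
      * sum_f_R0 (fun k => al k * be (S n - k)%nat) (S n)).
  rewrite !Hs, (IH (fun k => INR (S k) * al (S k))),
    (IH al (fun k => INR (S k) * be (S k))).
  rewrite fact_simpl, mult_INR, <- Rmult_plus_distr_l.
  rewrite (Rmult_comm (INR (S n))), Rmult_assoc; f_equal.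
  rewrite scal_sum; symmetry.
  rewrite (sum_eq _ (fun k => INR k * al k * be (S n - k)%nat
    + INR (S n - k) * al k * be (S n - k)%nat)).
  2: { intros k Hk; rewrite minus_INR by lia; ring. }
  rewrite sum_plus; f_equal.
  - rewrite decomp_sum by lia; simpl pred.
    replace (INR 0 * al 0%nat * be (S n - 0)%nat) with 0 by (simpl; ring).
    rewrite Rplus_0_l; apply sum_eq; intros k Hk.
    replace (S n - S k)%nat with (n - k)%nat by lia; ring.
  - rewrite tech5; replace (S n - S n)%nat with O by lia.
    simpl (INR 0); rewrite !Rmult_0_l, Rplus_0_r.
    apply sum_eq; intros k Hk.
    replace (S n - k)%nat with (S (n - k)) by lia; ring.
Qed.

(* The derivatives at 0 of the sum of s^n / (n + 1)^2, a function whose square is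
   majorized by a multiple of itself. *)
Definition phi (n : nat) : R := INR (fact n) * / (INR (S n) ^ 2).

Lemma phi_pos n : 0 < phi n.
Proof.
  apply Rmult_lt_0_compat; [apply lt_0_INR, lt_O_fact|].
  apply Rinv_0_lt_compat, pow_lt, lt_0_INR; lia.
Qed.

(** Telescoping: 1 / (x + 1)^2 <= 1 / x - 1 / (x + 1). *)
Lemma sum_inv_sqr n :
  sum_f_R0 (fun k => / (INR (S k) ^ 2)) n <= 2 - / INR (S n).
Proof.
  induction n as [|n IH]; [simpl; lra|].
  rewrite tech5; eapply Rle_trans; [apply Rplus_le_compat_r, IH|].
  rewrite (S_INR (S n)).
  assert (0 < INR (S n)) by (apply lt_0_INR; lia).
  set (x := INR (S n)) in *.
  enough (/ (x + 1) ^ 2 <= / x - / (x + 1)) by lra.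
  replace (/ x - / (x + 1)) with (/ (x * (x + 1))) by (field; lra).
  apply Rinv_le_contravar; nra.
Qed.

Lemma sum_rev (f : nat -> R) n :
  sum_f_R0 (fun k => f (n - k)%nat) n = sum_f_R0 f n.
Proof.
  induction n as [|n IH]; [reflexivity|].
  rewrite decomp_sum by lia; simpl pred.
  rewrite tech5, Rplus_comm; f_equal; exact IH.
Qed.

(** With x = k + 1, y = n - k + 1 and z = n + 1, the bound z^2 <= (x + y)^2 <= 2 (x^2 + y^2) gives 1
    / (x y)^2 <= (1 / x^2 + 1 / y^2) 2 / z^2. Each of the two sums of inverse squares is below 2,
    whence the constant 2 (2 + 2). *)
Lemma leibniz_phi n : leibniz phi phi n <= 8 * phi n.
Proof.
  unfold phi.
  rewrite (leibniz_fact (fun k => / (INR (S k) ^ 2))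
    (fun k => / (INR (S k) ^ 2))).
  replace (8 * (INR (fact n) * / INR (S n) ^ 2))
    with (INR (fact n) * (8 * / INR (S n) ^ 2)) by ring.
  apply Rmult_le_compat_l; [apply pos_INR|].
  assert (Hn : 0 < INR (S n)) by (apply lt_0_INR; lia).
  set (f := fun k => / (INR (S k) ^ 2)).
  apply Rle_trans with
    (sum_f_R0 (fun k => (f k + f (n - k)%nat) * (2 * / INR (S n) ^ 2)) n).
  - apply sum_Rle; intros k Hk; unfold f.
    assert (Hx : 0 < INR (S k)) by (apply lt_0_INR; lia).
    assert (Hy : 0 < INR (S (n - k))) by (apply lt_0_INR; lia).
    assert (Hxy : INR (S n) <= INR (S k) + INR (S (n - k)))
      by (rewrite <- plus_INR; apply le_INR; lia).
    set (x := INR (S k)) in *; set (y := INR (S (n - k))) in *;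
      set (z := INR (S n)) in *.
    replace ((/ x ^ 2 + / y ^ 2) * (2 * / z ^ 2))
      with ((/ x ^ 2 * / y ^ 2) * (2 * (x ^ 2 + y ^ 2) * / z ^ 2))
      by (field; lra).
    rewrite <- (Rmult_1_r (/ x ^ 2 * / y ^ 2)) at 1.
    apply Rmult_le_compat_l.
    + apply Rmult_le_pos; left; apply Rinv_0_lt_compat, pow_lt; assumption.
    + apply Rmult_le_reg_r with (z ^ 2); [apply pow_lt; assumption|].
      rewrite Rmult_assoc, Rinv_l, Rmult_1_l, Rmult_1_r
        by (apply pow_nonzero; lra).
      pose proof (pow_incr z (x + y) 2 ltac:(lra)).
      pose proof (pow2_ge_0 (x - y)); nra.
  - rewrite <- scal_sum, sum_plus, (sum_rev f).
    pose proof (sum_inv_sqr n) as Hs; fold f in Hs.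
    assert (0 < / INR (S n)) by (apply Rinv_0_lt_compat; assumption).
    assert (0 < / INR (S n) ^ 2)
      by (apply Rinv_0_lt_compat, pow_lt; assumption).
    nra.
Qed.

(** The majorant is K l! / (1 - R0 (t + x1 + x2))^(l + 1). Letting the order of the pole vary keeps
    the class closed under products and derivatives at the same [R0]. *)
Definition analytic_jet (R0 : R) (c : jet) : Prop :=
  exists K l, bounded_by R0 R0 (fun n => K * INR (fact (n + l))) c.

Lemma bounded_by_weaken a b a' b' A A' c :
  0 <= a <= a' -> 0 <= b <= b' -> (forall n, A n <= A' n) ->
  (forall n, 0 <= A' n) ->
  bounded_by a b A c -> bounded_by a' b' A' c.
Proof.
  intros Ha Hb HA HA' H i j k; eapply Rle_trans; [apply H|].
  assert (Hm : 0 <= a ^ i * b ^ j * a ^ k)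
    by (repeat apply Rmult_le_pos; apply pow_le; lra).
  eapply Rle_trans; [apply Rmult_le_compat_l; [exact Hm|apply HA]|].
  apply Rmult_le_compat_r; [apply HA'|].
  repeat apply Rmult_le_compat; try apply Rmult_le_pos;
    try (apply pow_le; lra); apply pow_incr; lra.
Qed.

Lemma bounded_by_add a b A B c d :
  bounded_by a b A c -> bounded_by a b B d ->
  bounded_by a b (fun n => A n + B n) (c + d)%jet.
Proof.
  intros Hc Hd i j k; unfold jadd.
  eapply Rle_trans; [apply Rabs_triang|].
  specialize (Hc i j k); specialize (Hd i j k); lra.
Qed.

Lemma bounded_by_sub a b A B c d :
  bounded_by a b A c -> bounded_by a b B d ->
  bounded_by a b (fun n => A n + B n) (c - d)%jet.
Proof.
  intros Hc Hd i j k; unfold jsub.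
  eapply Rle_trans; [apply Rabs_triang|].
  specialize (Hc i j k); specialize (Hd i j k); rewrite Rabs_Ropp; lra.
Qed.

Lemma bounded_by_const a b A r :
  0 <= a -> 0 <= b -> Rabs r <= A O -> (forall n, 0 <= A n) ->
  bounded_by a b A (jconst r).
Proof.
  intros Ha Hb H0 HA i j k.
  assert (Hm : 0 <= a ^ i * b ^ j * a ^ k)
    by (repeat apply Rmult_le_pos; apply pow_le; lra).
  destruct i as [|i]; destruct j as [|j]; destruct k as [|k];
    cbv beta iota delta [jconst]; try rewrite Rabs_R0; simpl plus;
    try (apply Rmult_le_pos; [exact Hm|apply HA]).
  simpl; lra.
Qed.

Lemma le_fact_add n l l' :
  (l <= l')%nat -> INR (fact (n + l)) <= INR (fact (n + l')).
Proof. intros; apply le_INR, fact_le; lia. Qed.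

(** Besides aligning two jets, this normalizes the constant of a single jet to be nonnegative when
    it is applied with [d] equal to [c]. *)
Lemma analytic_jet_same_shift R0 c d :
  0 <= R0 -> analytic_jet R0 c -> analytic_jet R0 d ->
  exists K l, 0 <= K /\
    bounded_by R0 R0 (fun n => K * INR (fact (n + l))) c /\
    bounded_by R0 R0 (fun n => K * INR (fact (n + l))) d.
Proof.
  intros HR [K [l Hc]] [K' [l' Hd]].
  exists (Rmax 0 (Rmax K K')), (Nat.max l l').
  pose proof (Rmax_l 0 (Rmax K K')); pose proof (Rmax_r 0 (Rmax K K')).
  pose proof (Rmax_l K K'); pose proof (Rmax_r K K').
  split; [assumption|].
  split; (eapply bounded_by_weaken;
    [split; [exact HR|apply Rle_refl]|split; [exact HR|apply Rle_refl]
    | |intros n; apply Rmult_le_pos; [assumption|apply pos_INR]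
    |eassumption]); intros n; cbv beta;
  (eapply Rle_trans; [apply Rmult_le_compat_r; [apply pos_INR|]
    |apply Rmult_le_compat_l; [assumption|apply le_fact_add]]);
  try lia; lra.
Qed.

Lemma analytic_jet_weaken R0 R1 c :
  0 <= R0 <= R1 -> analytic_jet R0 c -> analytic_jet R1 c.
Proof.
  intros HR Hc.
  destruct (analytic_jet_same_shift _ _ _ (proj1 HR) Hc Hc)
    as [K [l [HK [H _]]]].
  exists K, l; eapply bounded_by_weaken; [exact HR|exact HR| | |exact H].
  - intros; apply Rle_refl.
  - intros n; apply Rmult_le_pos; [assumption|apply pos_INR].
Qed.

Lemma analytic_jet_add R0 c d :
  0 <= R0 -> analytic_jet R0 c -> analytic_jet R0 d ->
  analytic_jet R0 (c + d)%jet.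
Proof.
  intros HR Hc Hd.
  destruct (analytic_jet_same_shift _ _ _ HR Hc Hd)
    as [K [l [HK [H1 H2]]]].
  exists (K + K), l; intros i j k.
  pose proof (bounded_by_add _ _ _ _ _ _ H1 H2 i j k); simpl in *; lra.
Qed.

Lemma analytic_jet_sub R0 c d :
  0 <= R0 -> analytic_jet R0 c -> analytic_jet R0 d ->
  analytic_jet R0 (c - d)%jet.
Proof.
  intros HR Hc Hd.
  destruct (analytic_jet_same_shift _ _ _ HR Hc Hd)
    as [K [l [HK [H1 H2]]]].
  exists (K + K), l; intros i j k.
  pose proof (bounded_by_sub _ _ _ _ _ _ H1 H2 i j k); simpl in *; lra.
Qed.

Lemma analytic_jet_const R0 r : 0 <= R0 -> analytic_jet R0 (jconst r).
Proof.
  intros HR; exists (Rabs r), O; apply bounded_by_const; auto.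
  - simpl; lra.
  - intros n; apply Rmult_le_pos; [apply Rabs_pos|apply pos_INR].
Qed.

(** The numbers (k + l)! are the derivatives at 0 of l! / (1 - s)^(l + 1), and the product of two
    such functions has a pole of order l + m + 2. *)
Lemma leibniz_fact_shift n l m :
  leibniz (fun k => INR (fact (k + l))) (fun k => INR (fact (k + m))) n
  = INR (fact l) * INR (fact m) / INR (fact (S (l + m)))
    * INR (fact (n + S (l + m))).
Proof.
  revert l m; induction n as [|n IH]; intros l m.
  - cbn [leibniz Nat.add]; field; apply INR_fact_neq_0.
  - cbn [leibniz Nat.add].
    assert (Hs : forall p, (fun k => INR (fact (S (k + p))))
      = (fun k => INR (fact (k + S p)))).
    { intros p; apply functional_extensionality; intro k.
      replace (k + S p)%nat with (S (k + p)) by lia; reflexivity. }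
    rewrite !Hs, (IH (S l) m), (IH l (S m)).
    replace (S (n + S (l + m)))%nat with (n + S (S (l + m)))%nat by lia.
    replace (S l + m)%nat with (S (l + m)) by lia.
    replace (l + S m)%nat with (S (l + m)) by lia.
    rewrite (fact_simpl (S (l + m))), (fact_simpl l), (fact_simpl m).
    rewrite !mult_INR, !S_INR, plus_INR.
    pose proof (pos_INR l); pose proof (pos_INR m).
    field; split; [apply INR_fact_neq_0|lra].
Qed.

Lemma analytic_jet_mul R0 c d :
  analytic_jet R0 c -> analytic_jet R0 d -> analytic_jet R0 (c * d)%jet.
Proof.
  intros [K [l Hc]] [K' [l' Hd]].
  pose proof (bounded_by_mul _ _ _ _ _ _ Hc Hd) as H.
  exists (K * (K' * (INR (fact l) * INR (fact l') / INR (fact (S (l + l')))))),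
    (S (l + l')); intros i j k.
  eapply Rle_trans; [apply H|right].
  rewrite leibniz_scal_l, leibniz_scal_r, leibniz_fact_shift.
  ring.
Qed.

Lemma analytic_jet_jd R0 c :
  analytic_jet R0 c ->
  analytic_jet R0 (jdt c) /\ analytic_jet R0 (jd1 c) /\
  analytic_jet R0 (jd2 c).
Proof.
  intros [K [l H]].
  assert (Hs : forall n, (S n + l)%nat = (n + S l)%nat) by (intros; lia).
  split; [|split]; exists (R0 * K), (S l); intros i j k.
  - pose proof (bounded_by_jdt _ _ _ _ H i j k) as H1; cbv beta in H1.
    rewrite Hs in H1; lra.
  - pose proof (bounded_by_jd1 _ _ _ _ H i j k) as H1; cbv beta in H1.
    rewrite Hs in H1; lra.
  - pose proof (bounded_by_jd2 _ _ _ _ H i j k) as H1; cbv beta in H1.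
    rewrite Hs in H1; lra.
Qed.

(** * Summation of jets *)

(** The coefficients are constant jets, so this derivation commutes with the partial derivatives.
    Its iterates reduce Taylor expansion in three variables to one variable along a ray. *)
Definition jdir (a b e : R) (c : jet) : jet :=
  (jconst a * jdt c + jconst b * jd1 c + jconst e * jd2 c)%jet.

Fixpoint dir (n : nat) (a b e : R) (c : jet) : R :=
  match n with O => c O O O | S m => dir m a b e (jdir a b e c) end.

Definition hom (n : nat) (t x y : R) (c : jet) : R :=
  dir n t x y c / INR (fact n).

(* Taylor's formula along the ray through (t, x, y). *)
Definition eval (c : jet) (t x y : R) : R := Series (fun n => hom n t x y c).

(** The factor 4 makes the Taylor terms decay like (1 / 2)^n, because [fact_shift_bound] costs 2^n
    for any shift. One region thus serves a jet and all its derivatives. *)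
Definition near (R0 t x y : R) : Prop :=
  4 * R0 * (Rabs t + Rabs x + Rabs y) < 1.

Lemma jdir_coef a b e c i j k :
  jdir a b e c i j k = a * jdt c i j k + b * jd1 c i j k + e * jd2 c i j k.
Proof. unfold jdir, jadd; rewrite !jmul_const_coef; ring. Qed.

Lemma jd_scal r c :
  jdt (jconst r * c) = (jconst r * jdt c)%jet /\
  jd1 (jconst r * c) = (jconst r * jd1 c)%jet /\
  jd2 (jconst r * c) = (jconst r * jd2 c)%jet.
Proof.
  split; [|split]; apply jet_ext; intros; unfold jdt, jd1, jd2;
    rewrite !jmul_const_coef; reflexivity.
Qed.

Lemma jdir_add a b e c d :
  jdir a b e (c + d)%jet = (jdir a b e c + jdir a b e d)%jet.
Proof.
  apply jet_ext; intros; unfold jadd at 2; rewrite !jdir_coef.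
  unfold jdt, jd1, jd2, jadd; ring.
Qed.

Lemma jdir_scal a b e r c :
  jdir a b e (jconst r * c)%jet = (jconst r * jdir a b e c)%jet.
Proof.
  unfold jdir; destruct (jd_scal r c) as [-> [-> ->]]; ring.
Qed.

Lemma jdir_mul a b e c d :
  jdir a b e (c * d)%jet = (jdir a b e c * d + c * jdir a b e d)%jet.
Proof. unfold jdir; destruct (jd_mul c d) as [-> [-> ->]]; ring. Qed.

Lemma jd_jdir a b e c :
  jdt (jdir a b e c) = jdir a b e (jdt c) /\
  jd1 (jdir a b e c) = jdir a b e (jd1 c) /\
  jd2 (jdir a b e c) = jdir a b e (jd2 c).
Proof.
  split; [|split]; apply jet_ext; intros; unfold jdt, jd1, jd2;
    rewrite !jdir_coef; reflexivity.
Qed.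

Lemma dir_add n a b e c d :
  dir n a b e (c + d)%jet = dir n a b e c + dir n a b e d.
Proof.
  revert c d; induction n as [|n IH]; intros c d; [reflexivity|].
  simpl; rewrite jdir_add; apply IH.
Qed.

Lemma dir_scal n a b e r c :
  dir n a b e (jconst r * c)%jet = r * dir n a b e c.
Proof.
  revert c; induction n as [|n IH]; intros c; [reflexivity|].
  simpl; rewrite jdir_scal; apply IH.
Qed.

Lemma dir_jdir n t x y a b e c :
  dir n t x y (jdir a b e c)
  = a * dir n t x y (jdt c) + b * dir n t x y (jd1 c)
    + e * dir n t x y (jd2 c).
Proof. unfold jdir; rewrite !dir_add, !dir_scal; reflexivity. Qed.

Lemma dir_mul n a b e c d :
  dir n a b e (c * d)%jet
  = leibniz (fun k => dir k a b e c) (fun k => dir k a b e d) n.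
Proof.
  revert c d; induction n as [|n IH]; intros c d; [reflexivity|].
  simpl; rewrite jdir_mul, dir_add, !IH; reflexivity.
Qed.

Lemma dir_bound R0 A c n t x y :
  bounded_by R0 R0 A c ->
  Rabs (dir n t x y c) <= (R0 * (Rabs t + Rabs x + Rabs y)) ^ n * A n.
Proof.
  revert A c; induction n as [|n IH]; intros A c H; simpl.
  - specialize (H O O O); simpl in H; lra.
  - set (s := Rabs t + Rabs x + Rabs y).
    apply Rle_trans with ((R0 * s) ^ n * ((R0 * s) * A (S n))); [|right; ring].
    apply (IH (fun n => R0 * s * A (S n))); intros i j k.
    rewrite jdir_coef.
    eapply Rle_trans; [apply Rabs_triang|].
    eapply Rle_trans; [apply Rplus_le_compat_r, Rabs_triang|].
    rewrite !Rabs_mult.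
    pose proof (Rmult_le_compat_l _ _ _ (Rabs_pos t)
      (bounded_by_jdt _ _ _ _ H i j k)).
    pose proof (Rmult_le_compat_l _ _ _ (Rabs_pos x)
      (bounded_by_jd1 _ _ _ _ H i j k)).
    pose proof (Rmult_le_compat_l _ _ _ (Rabs_pos y)
      (bounded_by_jd2 _ _ _ _ H i j k)).
    unfold s; lra.
Qed.

(** A binomial coefficient out of n + l is at most 2^(n + l); the double induction is Pascal's
    rule. *)
Lemma fact_shift_bound n l :
  INR (fact (n + l)) <= INR (fact l) * 2 ^ (n + l) * INR (fact n).
Proof.
  assert (H1 : forall m, 1 <= 2 ^ m) by (intros; apply pow_R1_Rle; lra).
  revert l; induction n as [|n IHn]; intros l.
  - simpl; rewrite Rmult_1_r.
    rewrite <- (Rmult_1_r (INR (fact l))) at 1.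
    apply Rmult_le_compat_l; [apply pos_INR|apply H1].
  - induction l as [|l IHl].
    + rewrite Nat.add_0_r; simpl (fact 0); simpl (INR 1); rewrite Rmult_1_l.
      rewrite <- (Rmult_1_l (INR (fact (S n)))) at 1.
      apply Rmult_le_compat_r; [apply pos_INR|apply H1].
    + specialize (IHn (S l)).
      replace (S n + S l)%nat with (S (S n + l)) by lia.
      replace (n + S l)%nat with (S n + l)%nat in IHn by lia.
      rewrite (fact_simpl (S n + l)), mult_INR.
      rewrite (fact_simpl l), (fact_simpl n), !mult_INR in *.
      replace (INR (S (S n + l))) with (INR (S n) + INR (S l))
        by (rewrite <- plus_INR; f_equal; lia).
      pose proof (Rmult_le_compat_l (INR (S n)) _ _ (pos_INR _) IHn).
      pose proof (Rmult_le_compat_l (INR (S l)) _ _ (pos_INR _) IHl).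
      change (2 ^ S (S n + l)) with (2 * 2 ^ (S n + l)); lra.
Qed.

Lemma hom_geom R0 c :
  0 < R0 -> analytic_jet R0 c ->
  exists K, 0 <= K /\ forall n t x y, near R0 t x y ->
    Rabs (hom n t x y c) <= K * (1 / 2) ^ n.
Proof.
  intros HR Hc.
  destruct (analytic_jet_same_shift _ _ _ (Rlt_le _ _ HR) Hc Hc)
    as [K [l [HK [H _]]]].
  exists (K * (INR (fact l) * 2 ^ l)); split.
  { repeat apply Rmult_le_pos; try apply pos_INR; [assumption|].
    apply pow_le; lra. }
  intros n t x y Hn; unfold near in Hn.
  pose proof (dir_bound _ _ _ n t x y H) as Hd; cbv beta in Hd.
  set (s := R0 * (Rabs t + Rabs x + Rabs y)) in *.
  assert (Hs : 0 <= s).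
  { apply Rmult_le_pos; [lra|].
    pose proof (Rabs_pos t); pose proof (Rabs_pos x); pose proof (Rabs_pos y);
    lra. }
  assert (Hf : 0 < INR (fact n)) by apply INR_fact_lt_0.
  unfold hom, Rdiv.
  rewrite Rabs_mult, (Rabs_pos_eq (/ _))
    by (left; apply Rinv_0_lt_compat; assumption).
  apply Rmult_le_reg_r with (INR (fact n)); [assumption|].
  rewrite Rmult_assoc, Rinv_l, Rmult_1_r by lra.
  eapply Rle_trans; [exact Hd|].
  apply Rle_trans with
    (s ^ n * (K * (INR (fact l) * 2 ^ (n + l) * INR (fact n)))).
  { apply Rmult_le_compat_l; [apply pow_le; exact Hs|].
    apply Rmult_le_compat_l; [exact HK|apply fact_shift_bound]. }
  rewrite pow_add.
  replace (s ^ n * (K * (INR (fact l) * (2 ^ n * 2 ^ l) * INR (fact n))))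
    with ((s * 2) ^ n * (K * (INR (fact l) * 2 ^ l) * INR (fact n)))
    by (rewrite Rpow_mult_distr; ring).
  replace (K * (INR (fact l) * 2 ^ l) * (1 * / 2) ^ n * INR (fact n))
    with ((1 * / 2) ^ n * (K * (INR (fact l) * 2 ^ l) * INR (fact n))) by ring.
  apply Rmult_le_compat_r.
  - repeat apply Rmult_le_pos; try apply pos_INR; [assumption|].
    apply pow_le; lra.
  - apply pow_incr; unfold s in *; lra.
Qed.

Lemma is_series_half K : is_series (fun n => K * (1 / 2) ^ n) (K * 2).
Proof.
  pose proof (is_series_geom (1 / 2)) as H.
  rewrite Rabs_pos_eq in H by lra; specialize (H ltac:(lra)).
  apply (is_series_scal K) in H.
  replace (K * 2) with (scal K (/ (1 - 1 / 2)))
    by (unfold scal; simpl; unfold mult; simpl; lra).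
  exact H.
Qed.

Lemma ex_series_half (a : nat -> R) K :
  (forall n, Rabs (a n) <= K * (1 / 2) ^ n) ->
  ex_series (fun n => Rabs (a n)) /\ Rabs (Series a) <= K * 2.
Proof.
  intros H.
  assert (Ha : ex_series (fun n => Rabs (a n))).
  { apply (@ex_series_le R_AbsRing R_CompleteNormedModule _
      (fun n => K * (1 / 2) ^ n)).
    - intros n; change norm with Rabs; simpl; rewrite Rabs_Rabsolu; apply H.
    - eexists; apply is_series_half. }
  split; [exact Ha|].
  eapply Rle_trans; [apply Series_Rabs; exact Ha|].
  rewrite <- (is_series_unique _ _ (is_series_half K)).
  apply Series_le; [|eexists; apply is_series_half].
  intros n; split; [apply Rabs_pos|apply H].
Qed.

Lemma ex_series_hom R0 c t x y :
  0 < R0 -> analytic_jet R0 c -> near R0 t x y ->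
  ex_series (fun n => Rabs (hom n t x y c)).
Proof.
  intros HR Hc Hn; destruct (hom_geom _ _ HR Hc) as [K [_ H]].
  apply (ex_series_half _ K); intros n; apply H; exact Hn.
Qed.

Lemma eval_bounded R0 c :
  0 < R0 -> analytic_jet R0 c ->
  exists K, forall t x y, near R0 t x y -> Rabs (eval c t x y) <= K.
Proof.
  intros HR Hc; destruct (hom_geom _ _ HR Hc) as [K [_ H]].
  exists (K * 2); intros t x y Hn.
  apply (ex_series_half (fun n => hom n t x y c) K); intros n; apply H;
    exact Hn.
Qed.

Lemma eval_add R0 c d t x y :
  0 < R0 -> analytic_jet R0 c -> analytic_jet R0 d -> near R0 t x y ->
  eval (c + d)%jet t x y = eval c t x y + eval d t x y.
Proof.
  intros HR Hc Hd Hn; unfold eval.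
  rewrite <- Series_plus
    by (apply ex_series_Rabs; eapply ex_series_hom; eassumption).
  apply Series_ext; intros n; unfold hom; rewrite dir_add.
  unfold Rdiv; ring.
Qed.

Lemma eval_scal r c t x y :
  eval (jconst r * c)%jet t x y = r * eval c t x y.
Proof.
  unfold eval; rewrite <- Series_scal_l.
  apply Series_ext; intros n; unfold hom; rewrite dir_scal.
  unfold Rdiv; ring.
Qed.

(** Along a ray the product of jets becomes a Cauchy product of two absolutely convergent series. *)
Lemma eval_mul R0 c d t x y :
  0 < R0 -> analytic_jet R0 c -> analytic_jet R0 d -> near R0 t x y ->
  eval (c * d)%jet t x y = eval c t x y * eval d t x y.
Proof.
  intros HR Hc Hd Hn.
  pose proof (ex_series_hom _ _ _ _ _ HR Hc Hn) as H1.
  pose proof (ex_series_hom _ _ _ _ _ HR Hd Hn) as H2.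
  assert (Hh : forall c, (fun k => dir k t x y c)
    = (fun k => INR (fact k) * hom k t x y c)).
  { intros e; apply functional_extensionality; intro k; unfold hom.
    field; apply INR_fact_neq_0. }
  assert (HE : forall n, sum_f_R0
    (fun k => hom k t x y c * hom (n - k) t x y d) n
    = hom n t x y (c * d)%jet).
  { intros n; unfold hom at 3; rewrite dir_mul, (Hh c), (Hh d), leibniz_fact.
    field; apply INR_fact_neq_0. }
  apply is_series_unique; eapply is_series_ext; [exact HE|].
  apply (is_series_mult (fun n => hom n t x y c) (fun n => hom n t x y d));
    [apply Series_correct, ex_series_Rabs; exact H1
    |apply Series_correct, ex_series_Rabs; exact H2|exact H1|exact H2].
Qed.

Lemma eval_const r t x y : eval (jconst r) t x y = r.
Proof.
  assert (H0 : forall n, dir n t x y (jconst 0) = 0).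
  { induction n as [|n IH]; [reflexivity|]; simpl.
    rewrite dir_jdir; destruct (jd_const 0) as [-> [-> ->]]; rewrite IH; ring. }
  apply is_series_unique, is_series_decr_1.
  replace (plus r _) with (0 * 2)
    by (unfold plus, opp, hom; simpl; field).
  apply is_series_ext with (fun n => 0 * (1 / 2) ^ n); [|apply is_series_half].
  intros n; rewrite Rmult_0_l; unfold hom; simpl dir.
  rewrite dir_jdir; destruct (jd_const r) as [-> [-> ->]].
  rewrite H0; unfold Rdiv; symmetry; rewrite !Rmult_0_r, !Rplus_0_r.
  apply Rmult_0_l.
Qed.

Lemma is_derive_quadratic (f : R -> R) s l M eps :
  0 < eps ->
  (forall s', Rabs (s' - s) < eps ->
    Rabs (f s' - f s - (s' - s) * l) <= M * (s' - s) ^ 2) ->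
  is_derive f s l.
Proof.
  intros Heps H; apply is_derive_Reals; intros e He.
  assert (HM : 0 < Rabs M + 1) by (pose proof (Rabs_pos M); lra).
  assert (Hd : 0 < Rmin eps (e / (Rabs M + 1)))
    by (apply Rmin_pos; [|apply Rdiv_lt_0_compat]; assumption).
  exists (mkposreal _ Hd); intros h Hh Hhd; simpl in Hhd.
  pose proof (Rmin_l eps (e / (Rabs M + 1))).
  pose proof (Rmin_r eps (e / (Rabs M + 1))).
  specialize (H (s + h)).
  replace (s + h - s) with h in H by ring; specialize (H ltac:(lra)).
  assert (Hh' : 0 < Rabs h) by (apply Rabs_pos_lt; exact Hh).
  replace ((f (s + h) - f s) / h - l) with ((f (s + h) - f s - h * l) / h)
    by (field; exact Hh).
  unfold Rdiv; rewrite Rabs_mult, Rabs_inv.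
  apply Rmult_lt_reg_r with (Rabs h); [exact Hh'|].
  rewrite Rmult_assoc, Rinv_l, Rmult_1_r by lra.
  eapply Rle_lt_trans; [exact H|].
  rewrite <- (pow2_abs h).
  assert (Hlt : Rabs h * (Rabs M + 1) < e).
  { apply Rmult_lt_reg_r with (/ (Rabs M + 1));
      [apply Rinv_0_lt_compat; exact HM|].
    rewrite Rmult_assoc, Rinv_r, Rmult_1_r by lra; unfold Rdiv in *; lra. }
  pose proof (Rle_abs M); nra.
Qed.

Lemma analytic_jet_jdir R0 a b e c :
  0 <= R0 -> analytic_jet R0 c -> analytic_jet R0 (jdir a b e c).
Proof.
  intros HR Hc; destruct (analytic_jet_jd _ _ Hc) as [H1 [H2 H3]].
  unfold jdir; repeat apply analytic_jet_add; auto;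
    apply analytic_jet_mul; auto using analytic_jet_const.
Qed.

(** As a function of its direction, [dir n] is a homogeneous polynomial of degree n. Its derivative
    along (a, b, e) is n times the polarized form with one slot filled by that vector. *)
Lemma is_derive_dir t x y a b e n c s :
  is_derive (fun s => dir n (t + s * a) (x + s * b) (y + s * e) c) s
    (INR n * dir (pred n) (t + s * a) (x + s * b) (y + s * e) (jdir a b e c)).
Proof.
  revert c; induction n as [|n IH]; intros c.
  { rewrite Rmult_0_l; exact (is_derive_const (c O O O) s). }
  apply is_derive_ext with (fun s =>
    (t + s * a) * dir n (t + s * a) (x + s * b) (y + s * e) (jdt c)
    + (x + s * b) * dir n (t + s * a) (x + s * b) (y + s * e) (jd1 c)
    + (y + s * e) * dir n (t + s * a) (x + s * b) (y + s * e) (jd2 c)).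
  { intros u; symmetry; apply dir_jdir. }
  assert (HP : forall p q, is_derive (fun s => p + s * q) s q)
    by (intros; auto_derive; [trivial|ring]).
  assert (Hm : forall (f g : R -> R) f' g', is_derive f s f' ->
    is_derive g s g' -> is_derive (fun s => f s * g s) s (f' * g s + f s * g')).
  { intros f g f' g' Hf Hg.
    apply (is_derive_mult f g s f' g' Hf Hg); intros; apply Rmult_comm. }
  pose proof (is_derive_plus _ _ _ _ _ (is_derive_plus _ _ _ _ _
    (Hm _ _ _ _ (HP t a) (IH (jdt c))) (Hm _ _ _ _ (HP x b) (IH (jd1 c))))
    (Hm _ _ _ _ (HP y e) (IH (jd2 c)))) as H.
  match type of H with is_derive _ _ ?l =>
    replace (INR (S n) * _) with l; [exact H|] end.
  clear; rewrite S_INR; unfold plus; simpl.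
  match goal with |- ?l = ?r => change (@eq R l r) end.
  set (p1 := t + s * a); set (p2 := x + s * b); set (p3 := y + s * e).
  (* Differentiating the explicit factors yields one copy of the term and the induction hypothesis n
     more, because directional derivatives commute. *)
  transitivity (dir n p1 p2 p3 (jdir a b e c)
    + INR n * dir (pred n) p1 p2 p3 (jdir p1 p2 p3 (jdir a b e c))).
  - rewrite !dir_jdir.
    destruct (jd_jdir a b e c) as [-> [-> ->]]; rewrite !dir_jdir; ring.
  - destruct n as [|n]; [simpl; ring|]; simpl pred; simpl dir; ring.
Qed.

Lemma is_derive_hom t x y a b e n c s :
  is_derive (fun s => hom (S n) (t + s * a) (x + s * b) (y + s * e) c) s
    (hom n (t + s * a) (x + s * b) (y + s * e) (jdir a b e c)).
Proof.
  pose proof (is_derive_scal _ s (/ INR (fact (S n))) _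
    (is_derive_dir t x y a b e (S n) c s)) as H.
  eapply is_derive_ext; [|match type of H with is_derive _ _ ?l =>
    replace (hom n _ _ _ _) with l; [exact H|] end].
  - intros u; unfold hom, Rdiv; apply Rmult_comm.
  - unfold hom; simpl pred; rewrite fact_simpl, mult_INR.
    field; split; [apply INR_fact_neq_0|apply not_0_INR; lia].
Qed.

Lemma near_open R0 t x y :
  0 < R0 -> near R0 t x y ->
  exists eps, 0 < eps /\ forall t' x' y', Rabs (t' - t) < eps ->
    Rabs (x' - x) < eps -> Rabs (y' - y) < eps -> near R0 t' x' y'.
Proof.
  intros HR Hn; unfold near in *.
  exists ((1 - 4 * R0 * (Rabs t + Rabs x + Rabs y)) / (12 * R0)); split.
  { apply Rdiv_lt_0_compat; lra. }
  set (eps := _ / (12 * R0)); intros t' x' y' Ht Hx Hy.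
  assert (He : 12 * R0 * eps = 1 - 4 * R0 * (Rabs t + Rabs x + Rabs y))
    by (unfold eps; field; lra).
  assert (Ht' := Rabs_triang (t' - t) t).
  assert (Hx' := Rabs_triang (x' - x) x).
  assert (Hy' := Rabs_triang (y' - y) y).
  replace (t' - t + t) with t' in Ht' by ring.
  replace (x' - x + x) with x' in Hx' by ring.
  replace (y' - y + y) with y' in Hy' by ring.
  assert (Rabs t' + Rabs x' + Rabs y' < Rabs t + Rabs x + Rabs y + 3 * eps)
    by lra.
  nra.
Qed.

Lemma near_path R0 t x y a b e s :
  0 < R0 -> near R0 (t + s * a) (x + s * b) (y + s * e) ->
  exists eps, 0 < eps /\ forall s', Rabs (s' - s) < eps ->
    near R0 (t + s' * a) (x + s' * b) (y + s' * e).
Proof.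
  intros HR Hn; destruct (near_open _ _ _ _ HR Hn) as [eps [Heps H]].
  set (m := Rabs a + Rabs b + Rabs e + 1).
  pose proof (Rabs_pos a); pose proof (Rabs_pos b); pose proof (Rabs_pos e).
  assert (Hm : 0 < m) by (unfold m; lra).
  exists (eps / m); split; [apply Rdiv_lt_0_compat; assumption|].
  intros s' Hs.
  assert (Hs' : Rabs (s' - s) * m < eps).
  { apply Rmult_lt_reg_r with (/ m); [apply Rinv_0_lt_compat; exact Hm|].
    rewrite Rmult_assoc, Rinv_r, Rmult_1_r by lra; exact Hs. }
  pose proof (Rabs_pos (s' - s)).
  assert (Hq : forall p q, Rabs q <= m ->
    Rabs (p + s' * q - (p + s * q)) < eps).
  { intros p q Hq; replace (p + s' * q - (p + s * q)) with ((s' - s) * q)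
      by ring.
    rewrite Rabs_mult; nra. }
  apply H; apply Hq; unfold m; lra.
Qed.

Lemma mean_value (f df : R -> R) s s' :
  (forall u, Rmin s s' <= u <= Rmax s s' -> is_derive f u (df u)) ->
  exists u, Rabs (u - s) <= Rabs (s' - s) /\
    Rmin s s' <= u <= Rmax s s' /\ f s' - f s = df u * (s' - s).
Proof.
  intros H; destruct (MVT_gen f s s' df) as [u [Hu Hf]].
  - intros u Hu; apply H; lra.
  - intros u Hu; apply derivable_continuous_pt.
    exists (df u); apply is_derive_Reals, H; exact Hu.
  - exists u; split; [|split; assumption].
    revert Hu; unfold Rmin, Rmax; destruct (Rle_dec s s'); intros Hu;
      unfold Rabs; repeat destruct Rcase_abs; lra.
Qed.

(* Termwise Taylor expansion to second order along the path; the remainders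
   are dominated by a geometric series. *)
Lemma is_derive_eval R0 c t x y a b e s :
  0 < R0 -> analytic_jet R0 c ->
  near R0 (t + s * a) (x + s * b) (y + s * e) ->
  is_derive (fun s => eval c (t + s * a) (x + s * b) (y + s * e)) s
    (eval (jdir a b e c) (t + s * a) (x + s * b) (y + s * e)).
Proof.
  intros HR Hc Hn; set (d := jdir a b e c).
  assert (Hd : analytic_jet R0 d) by (apply analytic_jet_jdir; lra || auto).
  assert (Hdd : analytic_jet R0 (jdir a b e d))
    by (apply analytic_jet_jdir; lra || auto).
  destruct (hom_geom _ _ HR Hdd) as [K [HK Hb]].
  destruct (near_path _ _ _ _ _ _ _ _ HR Hn) as [eps [Heps Hnear]].
  apply is_derive_quadratic with (2 * K * 2) eps; [exact Heps|].
  intros s' Hs'.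
  set (h := s' - s).
  set (f := fun n u => hom n (t + u * a) (x + u * b) (y + u * e) c).
  set (g := fun n u => hom n (t + u * a) (x + u * b) (y + u * e) d).
  (* The derivative of the term of degree n + 1 has degree n, so its bound K (1 / 2)^n is rewritten
     as 2 K (1 / 2)^(n + 1). The term of degree 0 is constant. *)
  assert (Hg : forall n u, Rabs (u - s) < eps ->
    Rabs (g n u - g n s) <= 2 * K * (1 / 2) ^ n * Rabs (u - s)).
  { intros [|n] u Hu.
    - unfold g, hom; simpl; rewrite Rminus_diag, Rabs_R0.
      apply Rmult_le_pos; [lra|apply Rabs_pos].
    - destruct (mean_value (g (S n)) (fun v => hom n (t + v * a) (x + v * b)
        (y + v * e) (jdir a b e d)) s u) as [v [Hv [_ ->]]].
      { intros v _; apply is_derive_hom. }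
      rewrite Rabs_mult; apply Rmult_le_compat_r; [apply Rabs_pos|].
      eapply Rle_trans; [apply Hb, Hnear; lra|]; simpl; lra. }
  assert (Hf : forall n, Rabs (f (S n) s' - f (S n) s - h * g n s)
    <= 2 * K * h ^ 2 * (1 / 2) ^ n).
  { intros n.
    destruct (mean_value (f (S n)) (g n) s s') as [v [Hv [_ ->]]].
    { intros v _; apply is_derive_hom. }
    fold h; replace (g n v * h - h * g n s) with ((g n v - g n s) * h) by ring.
    rewrite Rabs_mult, <- (pow2_abs h).
    fold h in Hv, Hs'.
    pose proof (Hg n v ltac:(lra)) as Hgv.
    pose proof (pow_lt (1 / 2) n ltac:(lra)).
    assert (2 * K * (1 / 2) ^ n * Rabs (v - s)
      <= 2 * K * (1 / 2) ^ n * Rabs h)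
      by (apply Rmult_le_compat_l; [nra|exact Hv]).
    pose proof (Rabs_pos h).
    apply Rle_trans with (2 * K * (1 / 2) ^ n * Rabs h * Rabs h);
      [|right; ring].
    apply Rmult_le_compat_r; lra. }
  assert (He : forall c u, analytic_jet R0 c -> Rabs (u - s) < eps ->
    ex_series (fun n => hom n (t + u * a) (x + u * b) (y + u * e) c)).
  { intros c' u Hc' Hu; eapply ex_series_Rabs, ex_series_hom;
      [exact HR|exact Hc'|apply Hnear; exact Hu]. }
  assert (Hs0 : Rabs (s - s) < eps)
    by (rewrite Rminus_diag, Rabs_R0; exact Heps).
  destruct (ex_series_half (fun n => f (S n) s' - f (S n) s - h * g n s) _ Hf)
    as [_ HS].
  unfold eval; fold (f) (g).
  (* The constant term of degree 0 drops out of the difference; the term of degree n + 1 of [c] is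
     matched with the term of degree n of [d]. *)
  rewrite !(Series_incr_1 (fun n => hom n _ _ _ c)) by (apply He; assumption).
  pose proof (proj1 (ex_series_incr_1 _) (He c s' Hc Hs')) as E1.
  pose proof (proj1 (ex_series_incr_1 _) (He c s Hc Hs0)) as E2.
  pose proof (He d s Hd Hs0) as E3.
  rewrite Series_minus, Series_minus, Series_scal_l in HS;
    [|exact E1|exact E2|exact (ex_series_minus _ _ E1 E2)
    |exact (ex_series_scal_l h _ E3)].
  replace (2 * K * 2 * h ^ 2) with (2 * K * h ^ 2 * 2) by ring.
  eapply Rle_trans; [|exact HS]; right; f_equal.
  unfold f, g, h; unfold hom at 1 3; simpl dir; ring.
Qed.

Lemma near_convex R0 t x y t' x' y' s :
  0 < R0 -> 0 <= s <= 1 -> near R0 t x y -> near R0 t' x' y' ->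
  near R0 (t + s * (t' - t)) (x + s * (x' - x)) (y + s * (y' - y)).
Proof.
  intros HR Hs H H'; unfold near in *.
  assert (Ha : forall p q,
    Rabs (p + s * (q - p)) <= (1 - s) * Rabs p + s * Rabs q).
  { intros p q; replace (p + s * (q - p)) with ((1 - s) * p + s * q) by ring.
    eapply Rle_trans; [apply Rabs_triang|].
    rewrite !Rabs_mult, (Rabs_pos_eq s), (Rabs_pos_eq (1 - s)) by lra; lra. }
  pose proof (Ha t t'); pose proof (Ha x x'); pose proof (Ha y y').
  set (m := Rabs t + Rabs x + Rabs y) in *.
  set (m' := Rabs t' + Rabs x' + Rabs y') in *.
  apply Rle_lt_trans with ((1 - s) * (4 * R0 * m) + s * (4 * R0 * m')).
  - apply Rle_trans with (4 * R0 * ((1 - s) * m + s * m')); [|right; ring].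
    apply Rmult_le_compat_l; [lra|]; unfold m, m'; lra.
  - destruct (Rle_lt_or_eq_dec 0 s (proj1 Hs)) as [Hs0|<-]; [|lra]; nra.
Qed.

(** The mean value theorem on a segment, with bounded first derivatives. [Ck_on] requires joint
    continuity, which the existence of partial derivatives alone would not give. *)
Lemma eval_lipschitz R0 c :
  0 < R0 -> analytic_jet R0 c ->
  exists K, 0 < K /\ forall t x y t' x' y', near R0 t x y -> near R0 t' x' y' ->
    Rabs (eval c t' x' y' - eval c t x y)
    <= K * (Rabs (t' - t) + Rabs (x' - x) + Rabs (y' - y)).
Proof.
  intros HR Hc; destruct (analytic_jet_jd _ _ Hc) as [Ht [H1 H2]].
  destruct (eval_bounded _ _ HR Ht) as [K0 HK0].
  destruct (eval_bounded _ _ HR H1) as [K1 HK1].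
  destruct (eval_bounded _ _ HR H2) as [K2 HK2].
  exists (Rabs K0 + Rabs K1 + Rabs K2 + 1).
  pose proof (Rabs_pos K0); pose proof (Rabs_pos K1); pose proof (Rabs_pos K2).
  split; [lra|]; intros t x y t' x' y' Hn Hn'.
  destruct (mean_value
    (fun s => eval c (t + s * (t' - t)) (x + s * (x' - x)) (y + s * (y' - y)))
    (fun s => eval (jdir (t' - t) (x' - x) (y' - y) c)
       (t + s * (t' - t)) (x + s * (x' - x)) (y + s * (y' - y))) 0 1)
    as [u [_ [Hu Hf]]].
  { intros u Hu; rewrite Rmin_left, Rmax_right in Hu by lra.
    apply is_derive_eval with R0; auto; apply near_convex; auto. }
  rewrite Rmin_left, Rmax_right in Hu by lra.
  rewrite !Rmult_1_l, !Rmult_0_l, !Rplus_0_r in Hf.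
  replace (t + (t' - t)) with t' in Hf by ring.
  replace (x + (x' - x)) with x' in Hf by ring.
  replace (y + (y' - y)) with y' in Hf by ring.
  rewrite Hf, Rminus_0_r, Rmult_1_r.
  pose proof (near_convex _ _ _ _ _ _ _ _ HR Hu Hn Hn') as Hnu.
  unfold jdir.
  rewrite (eval_add R0), (eval_add R0), !eval_scal; try assumption;
    try (repeat apply analytic_jet_add; try lra; apply analytic_jet_mul;
         auto; apply analytic_jet_const; lra).
  specialize (HK0 _ _ _ Hnu); specialize (HK1 _ _ _ Hnu);
  specialize (HK2 _ _ _ Hnu).
  eapply Rle_trans; [apply Rabs_triang|].
  eapply Rle_trans; [apply Rplus_le_compat_r, Rabs_triang|].
  rewrite !Rabs_mult.
  pose proof (Rle_abs K0); pose proof (Rle_abs K1); pose proof (Rle_abs K2).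
  set (K := Rabs K0 + Rabs K1 + Rabs K2 + 1).
  assert (Hm : forall p q, 0 <= p -> q <= K -> p * q <= K * p)
    by (intros; nra).
  pose proof (Hm _ _ (Rabs_pos (t' - t))
    (Rle_trans _ _ K HK0 ltac:(unfold K; lra))).
  pose proof (Hm _ _ (Rabs_pos (x' - x))
    (Rle_trans _ _ K HK1 ltac:(unfold K; lra))).
  pose proof (Hm _ _ (Rabs_pos (y' - y))
    (Rle_trans _ _ K HK2 ltac:(unfold K; lra))).
  lra.
Qed.

(** * Functions represented by jets *)

Definition jet_fun (p0 : R * R * R) (c : jet) : field := fun p =>
  eval c (fst (fst p) - fst (fst p0)) (snd (fst p) - snd (fst p0))
    (snd p - snd p0).

Definition near_pt (R0 : R) (p0 p : R * R * R) : Prop :=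
  near R0 (fst (fst p) - fst (fst p0)) (snd (fst p) - snd (fst p0))
    (snd p - snd p0).

(** The region depends only on [p0] and [R0], and differentiation preserves it, so fields can be
    differentiated repeatedly without shrinking it. Fields with the same jet coincide there; this
    turns jet identities into identities of functions. *)
Definition expands (p0 : R * R * R) (R0 : R) (f : field) (c : jet) : Prop :=
  analytic_jet R0 c /\ forall p, near_pt R0 p0 p -> f p = jet_fun p0 c p.

Definition jd (i : idx) : jet -> jet :=
  match i with X1 => jd1 | X2 => jd2 end.

Lemma expands_weaken p0 R0 R1 f c :
  0 < R0 <= R1 -> expands p0 R0 f c -> expands p0 R1 f c.
Proof.
  intros HR [Hc Hf]; split; [apply analytic_jet_weaken with R0; auto; lra|].
  intros p Hp; apply Hf; unfold near_pt, near in *.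
  eapply Rle_lt_trans; [|exact Hp].
  apply Rmult_le_compat_r; [|lra].
  repeat apply Rplus_le_le_0_compat; apply Rabs_pos.
Qed.

Lemma expands_jet_fun p0 R0 c :
  analytic_jet R0 c -> expands p0 R0 (jet_fun p0 c) c.
Proof. intros Hc; split; auto. Qed.

Lemma expands_add p0 R0 f g c d :
  0 < R0 -> expands p0 R0 f c -> expands p0 R0 g d ->
  expands p0 R0 (fun p => f p + g p) (c + d)%jet.
Proof.
  intros HR [Hc Hf] [Hd Hg]; split; [apply analytic_jet_add; auto; lra|].
  intros p Hp; rewrite Hf, Hg by exact Hp; symmetry.
  apply eval_add with R0; assumption.
Qed.

Lemma expands_const p0 R0 r :
  0 < R0 -> expands p0 R0 (fun _ => r) (jconst r).
Proof.
  intros HR; split; [apply analytic_jet_const; lra|].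
  intros p Hp; symmetry; apply eval_const.
Qed.

Lemma expands_mul p0 R0 f g c d :
  0 < R0 -> expands p0 R0 f c -> expands p0 R0 g d ->
  expands p0 R0 (fun p => f p * g p) (c * d)%jet.
Proof.
  intros HR [Hc Hf] [Hd Hg]; split; [apply analytic_jet_mul; assumption|].
  intros p Hp; rewrite Hf, Hg by exact Hp; symmetry.
  apply eval_mul with R0; assumption.
Qed.

Lemma expands_ext p0 R0 f g c :
  (forall p, f p = g p) -> expands p0 R0 f c -> expands p0 R0 g c.
Proof. intros H [Hc Hf]; split; [exact Hc|]; intros; rewrite <- H; auto. Qed.

Lemma expands_sub p0 R0 f g c d :
  0 < R0 -> expands p0 R0 f c -> expands p0 R0 g d ->
  expands p0 R0 (fun p => f p - g p) (c - d)%jet.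
Proof.
  intros HR Hf Hg.
  replace (c - d)%jet with (c + jconst (-1) * d)%jet.
  - eapply expands_ext; [|apply expands_add; [exact HR|exact Hf|]].
    2: { apply expands_mul; [exact HR| |exact Hg].
         apply expands_const, HR. }
    intros p; simpl; ring.
  - apply jet_ext; intros; unfold jadd, jsub; rewrite jmul_const_coef; ring.
Qed.

Lemma expands_opp p0 R0 f c :
  0 < R0 -> expands p0 R0 f c -> expands p0 R0 (fun p => - f p) (- c)%jet.
Proof.
  intros HR Hf.
  replace (- c)%jet with (jconst (-1) * c)%jet.
  - eapply expands_ext; [|apply expands_mul; [exact HR| |exact Hf]].
    2: apply expands_const, HR.
    intros p; simpl; ring.
  - apply jet_ext; intros; unfold jopp; rewrite jmul_const_coef; ring.
Qed.

Lemma expands_sqr p0 R0 f c :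
  0 < R0 -> expands p0 R0 f c -> expands p0 R0 (fun p => f p ^ 2) (c * c)%jet.
Proof.
  intros HR Hf; eapply expands_ext; [|apply expands_mul; eassumption].
  intros p; simpl; ring.
Qed.

(** Evaluating the identity for [e] and [d] gives a product of values equal to 1, so [g] vanishes
    nowhere in the region and its reciprocal is the sum of [e]. *)
Lemma expands_div p0 R0 f g c d e :
  0 < R0 -> expands p0 R0 f c -> expands p0 R0 g d -> analytic_jet R0 e ->
  (e * d)%jet = jconst 1 -> expands p0 R0 (fun p => f p / g p) (c * e)%jet.
Proof.
  intros HR [Hc Hf] [Hd Hg] He Hed.
  split; [apply analytic_jet_mul; assumption|].
  intros p Hp; rewrite Hf, Hg by exact Hp; unfold jet_fun.
  rewrite (eval_mul R0) by assumption.
  unfold near_pt in Hp.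
  match goal with |- eval c ?t ?x ?y / _ = _ =>
    pose proof (eval_mul R0 e d t x y HR He Hd Hp) as H end.
  rewrite Hed, eval_const in H.
  unfold Rdiv; f_equal.
  match goal with |- / ?b = ?a => assert (b <> 0) by
    (intros H0; rewrite H0 in H; lra); apply Rmult_eq_reg_r with b end;
    [|assumption].
  rewrite <- H, Rinv_l by assumption; reflexivity.
Qed.

Lemma jet_fun_derive p0 R0 c t x y :
  0 < R0 -> analytic_jet R0 c -> near_pt R0 p0 (t, x, y) ->
  is_derive (fun s => jet_fun p0 c (s, x, y)) t (jet_fun p0 (jdt c) (t, x, y))
  /\ is_derive (fun s => jet_fun p0 c (t, s, y)) x
       (jet_fun p0 (jd1 c) (t, x, y))
  /\ is_derive (fun s => jet_fun p0 c (t, x, s)) y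
       (jet_fun p0 (jd2 c) (t, x, y)).
Proof.
  destruct p0 as [[t0 x0] y0]; intros HR Hc Hn.
  unfold jet_fun, near_pt in *; simpl in *.
  assert (He : forall a b e, eval (jdir a b e c) (t - t0) (x - x0) (y - y0)
    = a * eval (jdt c) (t - t0) (x - x0) (y - y0)
      + b * eval (jd1 c) (t - t0) (x - x0) (y - y0)
      + e * eval (jd2 c) (t - t0) (x - x0) (y - y0)).
  { intros a b e; destruct (analytic_jet_jd _ _ Hc) as [H1 [H2 H3]].
    unfold jdir; rewrite (eval_add R0), (eval_add R0), !eval_scal;
    try assumption; try reflexivity;
    try (repeat apply analytic_jet_add; try lra; apply analytic_jet_mul;
         auto; apply analytic_jet_const; lra). }
  pose proof (is_derive_eval R0 c (- t0) (x - x0) (y - y0) 1 0 0 t HR Hc) as Ht.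
  pose proof (is_derive_eval R0 c (t - t0) (- x0) (y - y0) 0 1 0 x HR Hc) as Hx.
  pose proof (is_derive_eval R0 c (t - t0) (x - x0) (- y0) 0 0 1 y HR Hc) as Hy.
  assert (E1 : forall p q, - p + q * 1 = q - p) by (intros; ring).
  assert (E0 : forall p q r, p - q + r * 0 = p - q) by (intros; ring).
  rewrite !E1, !E0, !He in Ht, Hx, Hy.
  specialize (Ht Hn); specialize (Hx Hn); specialize (Hy Hn).
  split; [|split].
  - replace (eval (jdt c) _ _ _) with
      (1 * eval (jdt c) (t - t0) (x - x0) (y - y0)
        + 0 * eval (jd1 c) (t - t0) (x - x0) (y - y0)
        + 0 * eval (jd2 c) (t - t0) (x - x0) (y - y0)) by ring.
    eapply is_derive_ext; [|exact Ht]; intros s; simpl; rewrite E1, !E0;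
    reflexivity.
  - replace (eval (jd1 c) _ _ _) with
      (0 * eval (jdt c) (t - t0) (x - x0) (y - y0)
        + 1 * eval (jd1 c) (t - t0) (x - x0) (y - y0)
        + 0 * eval (jd2 c) (t - t0) (x - x0) (y - y0)) by ring.
    eapply is_derive_ext; [|exact Hx]; intros s; simpl; rewrite E1, !E0;
    reflexivity.
  - replace (eval (jd2 c) _ _ _) with
      (0 * eval (jdt c) (t - t0) (x - x0) (y - y0)
        + 0 * eval (jd1 c) (t - t0) (x - x0) (y - y0)
        + 1 * eval (jd2 c) (t - t0) (x - x0) (y - y0)) by ring.
    eapply is_derive_ext; [|exact Hy]; intros s; simpl; rewrite E1, !E0;
    reflexivity.
Qed.

Lemma near_pt_open p0 R0 t x y :
  0 < R0 -> near_pt R0 p0 (t, x, y) ->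
  exists eps : posreal, forall t' x' y',
    Rabs (t' - t) < eps -> Rabs (x' - x) < eps -> Rabs (y' - y) < eps ->
    near_pt R0 p0 (t', x', y').
Proof.
  intros HR Hn; destruct (near_open _ _ _ _ HR Hn) as [eps [Heps H]].
  exists (mkposreal _ Heps); intros t' x' y' Ht Hx Hy.
  simpl in *; apply H; simpl.
  - replace (_ - _ - _) with (t' - t) by ring; exact Ht.
  - replace (_ - _ - _) with (x' - x) by ring; exact Hx.
  - replace (_ - _ - _) with (y' - y) by ring; exact Hy.
Qed.

Lemma expands_derive p0 R0 f c t x y :
  0 < R0 -> expands p0 R0 f c -> near_pt R0 p0 (t, x, y) ->
  is_derive (fun s => f (s, x, y)) t (jet_fun p0 (jdt c) (t, x, y)) /\
  is_derive (fun s => f (t, s, y)) x (jet_fun p0 (jd1 c) (t, x, y)) /\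
  is_derive (fun s => f (t, x, s)) y (jet_fun p0 (jd2 c) (t, x, y)).
Proof.
  intros HR [Hc Hf] Hn.
  destruct (jet_fun_derive p0 R0 c t x y HR Hc Hn) as [H1 [H2 H3]].
  destruct (near_pt_open _ _ _ _ _ HR Hn) as [eps Heps].
  assert (H0 : forall u : R, Rabs (u - u) < eps)
    by (intros; rewrite Rminus_diag, Rabs_R0; apply cond_pos).
  split; [|split].
  - eapply is_derive_ext_loc; [|exact H1].
    exists eps; intros s Hs; symmetry; apply Hf, Heps; auto.
  - eapply is_derive_ext_loc; [|exact H2].
    exists eps; intros s Hs; symmetry; apply Hf, Heps; auto.
  - eapply is_derive_ext_loc; [|exact H3].
    exists eps; intros s Hs; symmetry; apply Hf, Heps; auto.
Qed.

Lemma expands_Dt p0 R0 f c :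
  0 < R0 -> expands p0 R0 f c -> expands p0 R0 (Dt f) (jdt c).
Proof.
  intros HR Hf; split; [exact (proj1 (analytic_jet_jd _ _ (proj1 Hf)))|].
  intros [[t x] y] Hn.
  apply is_derive_unique, (expands_derive p0 R0 f c t x y HR Hf Hn).
Qed.

Lemma expands_D p0 R0 i f c :
  0 < R0 -> expands p0 R0 f c -> expands p0 R0 (Defs.D i f) (jd i c).
Proof.
  intros HR Hf; destruct (analytic_jet_jd _ _ (proj1 Hf)) as [_ [H1 H2]].
  split; [destruct i; assumption|].
  intros [[t x] y] Hn.
  destruct i; apply is_derive_unique;
    apply (expands_derive p0 R0 f c t x y HR Hf Hn).
Qed.

Lemma ball_prod3 (t x y t' x' y' : R) (eps : R) :
  ball (t, x, y) eps (t', x', y') <->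
  Rabs (t' - t) < eps /\ Rabs (x' - x) < eps /\ Rabs (y' - y) < eps.
Proof.
  split; [intros [[H1 H2] H3]|intros [H1 [H2 H3]]]; repeat split; assumption.
Qed.

Lemma expands_continuous p0 R0 f c p :
  0 < R0 -> expands p0 R0 f c -> near_pt R0 p0 p -> continuous f p.
Proof.
  destruct p as [[t x] y]; intros HR [Hc Hf] Hn.
  destruct (near_pt_open _ _ _ _ _ HR Hn) as [eps Heps].
  destruct (eval_lipschitz _ _ HR Hc) as [K [HK HL]].
  apply filterlim_locally; intros e.
  assert (Hd : 0 < Rmin eps (e / (3 * K))).
  { apply Rmin_pos; [apply cond_pos|].
    apply Rdiv_lt_0_compat; [apply cond_pos|lra]. }
  exists (mkposreal _ Hd); intros [[t' x'] y'] Hb.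
  apply ball_prod3 in Hb; simpl in Hb; destruct Hb as [Ht [Hx Hy]].
  pose proof (Rmin_l eps (e / (3 * K))); pose proof (Rmin_r eps (e / (3 * K))).
  assert (Hn' : near_pt R0 p0 (t', x', y')) by (apply Heps; lra).
  change (Rabs (f (t', x', y') - f (t, x, y)) < e).
  rewrite !Hf by assumption; unfold jet_fun; simpl.
  eapply Rle_lt_trans; [apply HL; assumption|].
  replace (t' - _ - (t - _)) with (t' - t) by ring.
  replace (x' - _ - (x - _)) with (x' - x) by ring.
  replace (y' - _ - (y - _)) with (y' - y) by ring.
  apply Rlt_le_trans with (K * (3 * (e / (3 * K)))); [|right; field; lra].
  apply Rmult_lt_compat_l; lra.
Qed.

Lemma expands_smooth p0 R0 (U : R * R * R -> Prop) f c :
  0 < R0 -> (forall p, U p -> near_pt R0 p0 p) ->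
  expands p0 R0 f c -> smooth_on U f.
Proof.
  intros HR HU Hf n; revert f c Hf; induction n as [|n IH]; intros f c Hf.
  - split; [|trivial]; intros p Hp; apply expands_continuous with p0 R0 c; auto.
  - split; [|split; [|split]].
    + intros p Hp; apply expands_continuous with p0 R0 c; auto.
    + intros [[t x] y] Hp.
      destruct (expands_derive p0 R0 f c t x y HR Hf (HU _ Hp))
        as [H1 [H2 H3]].
      repeat split; eexists; eassumption.
    + apply IH with (jdt c), expands_Dt; assumption.
    + intros i; apply IH with (jd i c), expands_D; assumption.
Qed.

(** * Taylor jets of analytic functions *)

Lemma sum_degree_Reals w n :
  sum_degree w n
  = sum_f_R0 (fun i => sum_f_R0 (fun j => w i j (n - i - j)%nat) (n - i)) n.
Proof.
  unfold sum_degree; rewrite sum_n_Reals; apply sum_eq; intros i _.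
  apply sum_n_Reals.
Qed.

(* Euler's identity for a homogeneous polynomial with monomials [w i j k]. *)
Lemma sum_degree_euler w n :
  INR (S n) * sum_degree w (S n)
  = sum_degree (fun i j k => INR (S i) * w (S i) j k) n
    + sum_degree (fun i j k => INR (S j) * w i (S j) k) n
    + sum_degree (fun i j k => INR (S k) * w i j (S k)) n.
Proof.
  rewrite !sum_degree_Reals.
  transitivity (sum_f_R0 (fun i => sum_f_R0 (fun j =>
      INR i * w i j (S n - i - j)%nat) (S n - i)) (S n)
    + sum_f_R0 (fun i => sum_f_R0 (fun j =>
      INR j * w i j (S n - i - j)%nat) (S n - i)) (S n)
    + sum_f_R0 (fun i => sum_f_R0 (fun j =>
      INR (S n - i - j) * w i j (S n - i - j)%nat) (S n - i)) (S n)).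
  { rewrite <- !sum_plus, scal_sum; apply sum_eq; intros i Hi.
    rewrite <- !sum_plus, Rmult_comm, scal_sum; apply sum_eq; intros j Hj.
    replace (INR (S n)) with (INR i + INR j + INR (S n - i - j))
      by (rewrite <- !plus_INR; f_equal; lia).
    ring. }
  f_equal; [f_equal|].
  - rewrite decomp_sum by lia; simpl pred.
    replace (sum_f_R0 (fun j => INR 0 * _) _) with 0.
    2: { symmetry; apply sum_eq_R0; intros; simpl; ring. }
    rewrite Rplus_0_l; apply sum_eq; intros i Hi.
    apply sum_eq; reflexivity.
  - rewrite tech5, Nat.sub_diag; simpl (sum_f_R0 _ 0).
    rewrite Rmult_0_l, Rplus_0_r; apply sum_eq; intros i Hi.
    replace (S n - i)%nat with (S (n - i)) by lia.
    rewrite decomp_sum by lia; simpl pred.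
    replace (INR 0) with 0 by reflexivity; rewrite Rmult_0_l, Rplus_0_l.
    apply sum_eq; reflexivity.
  - rewrite tech5, Nat.sub_diag; simpl (sum_f_R0 _ 0).
    rewrite Rmult_0_l, Rplus_0_r; apply sum_eq; intros i Hi.
    replace (S n - i)%nat with (S (n - i)) by lia.
    rewrite tech5, Nat.sub_diag; replace (INR 0) with 0 by reflexivity.
    rewrite Rmult_0_l, Rplus_0_r; apply sum_eq; intros j Hj.
    replace (S (n - i) - j)%nat with (S (n - i - j)) by lia; reflexivity.
Qed.

Lemma sum_degree_scal r w n :
  sum_degree (fun i j k => r * w i j k) n = r * sum_degree w n.
Proof.
  rewrite !sum_degree_Reals, scal_sum; apply sum_eq; intros i _.
  rewrite (Rmult_comm _ r), scal_sum; apply sum_eq; intros; ring.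
Qed.

Lemma sum_degree_ext w w' n :
  (forall i j k, w i j k = w' i j k) -> sum_degree w n = sum_degree w' n.
Proof.
  intros H; rewrite !sum_degree_Reals; apply sum_eq; intros i _.
  apply sum_eq; intros j _; apply H.
Qed.

(** Both sides obey the same recursion in the degree: Euler's identity for the sum of monomials, one
    more directional derivative for [hom]. *)
Lemma hom_sum_degree n s y z c :
  hom n s y z c = sum_degree (fun i j k =>
    c i j k / (INR (fact i) * INR (fact j) * INR (fact k))
    * s ^ i * y ^ j * z ^ k) n.
Proof.
  unfold hom; revert c; induction n as [|n IH]; intros c.
  - rewrite sum_degree_Reals; simpl; field.
  - set (w := fun i j k => _).
    apply Rmult_eq_reg_l with (INR (S n)); [|apply not_0_INR; lia].
    rewrite sum_degree_euler; simpl dir; rewrite dir_jdir.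
    transitivity (s * (dir n s y z (jdt c) / INR (fact n))
      + y * (dir n s y z (jd1 c) / INR (fact n))
      + z * (dir n s y z (jd2 c) / INR (fact n))).
    { rewrite fact_simpl, mult_INR; field.
      split; [apply INR_fact_neq_0|apply not_0_INR; lia]. }
    rewrite !IH, <- !sum_degree_scal.
    assert (Hf : forall m, INR (S m) <> 0) by (intros; apply not_0_INR; lia).
    f_equal; [f_equal|]; apply sum_degree_ext; intros i j k;
      unfold w, jdt, jd1, jd2; rewrite (fact_simpl _), mult_INR;
      cbn [pow]; field; repeat split; auto using INR_fact_neq_0.
Qed.

Lemma sum_f_R0_ge_term (f : nat -> R) n i :
  (forall k, 0 <= f k) -> (i <= n)%nat -> f i <= sum_f_R0 f n.
Proof.
  intros Hf; induction n as [|n IH]; intros Hi.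
  - replace i with O by lia; simpl; lra.
  - rewrite tech5; destruct (Nat.eq_dec i (S n)) as [->|Hne].
    + pose proof (cond_pos_sum f n Hf); lra.
    + pose proof (IH ltac:(lia)); pose proof (Hf (S n)); lra.
Qed.

Lemma sum_degree_ge_term w i j k :
  (forall i j k, 0 <= w i j k) -> w i j k <= sum_degree w (i + j + k).
Proof.
  intros Hw; rewrite sum_degree_Reals.
  eapply Rle_trans; [|apply (sum_f_R0_ge_term _ _ i); [|lia]].
  - eapply Rle_trans; [|apply (sum_f_R0_ge_term _ _ j); [|lia]].
    + cbv beta; replace (i + j + k - i - j)%nat with k by lia; apply Rle_refl.
    + intros; apply Hw.
  - intros l; apply cond_pos_sum; intros; apply Hw.
Qed.

Lemma ex_series_bounded (f : nat -> R) :
  (forall n, 0 <= f n) -> ex_series f -> exists M, forall n, f n <= M.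
Proof.
  intros Hf [l Hl]; exists l; intros n.
  apply Rle_trans with (sum_f_R0 f n); [apply sum_f_R0_ge_term; auto|].
  apply sum_incr; [|exact Hf].
  apply is_lim_seq_Reals; eapply is_lim_seq_ext; [|exact Hl].
  intros m; apply sum_n_Reals.
Qed.

Lemma fact_mul_le i j : (fact i * fact j <= fact (i + j))%nat.
Proof.
  induction i as [|i IH]; simpl; [lia|].
  pose proof (Nat.mul_le_mono i (i + j) _ _ ltac:(lia) IH); lia.
Qed.

(** Cauchy's estimate: absolute convergence at the increment (q, q, q) bounds |a_ijk| q^(i + j + k)
    by some M, so the derivatives i! j! k! a_ijk are at most M (i + j + k)! / q^(i + j + k) in
    absolute value. *)
Lemma expands_of_analytic f t x y :
  analytic_at f (t, x, y) -> exists R0 c, 0 < R0 /\ expands (t, x, y) R0 f c.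
Proof.
  intros [a [r H]]; pose proof (cond_pos r) as Hr.
  set (q := r / 2); assert (Hq : 0 < q) by (unfold q; lra).
  assert (Hqr : Rabs q < r) by (rewrite Rabs_pos_eq; unfold q; lra).
  destruct (H q q q Hqr Hqr Hqr) as [Hex _].
  apply ex_series_bounded in Hex.
  2: { intros n; rewrite sum_degree_Reals; apply cond_pos_sum; intros i;
       apply cond_pos_sum; intros j; apply Rabs_pos. }
  destruct Hex as [M HM].
  set (c := fun i j k => INR (fact i) * INR (fact j) * INR (fact k) * a i j k).
  exists (/ q), c; split; [apply Rinv_0_lt_compat; exact Hq|].
  split.
  - exists M, O; intros i j k.
    specialize (HM (i + j + k)%nat).
    assert (Ha : Rabs (a i j k) * q ^ (i + j + k) <= M).
    { eapply Rle_trans; [|exact HM].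
      eapply Rle_trans; [|apply sum_degree_ge_term; intros; apply Rabs_pos].
      rewrite !Rabs_mult, <- !RPow_abs, !(Rabs_pos_eq q) by lra.
      rewrite !pow_add; right; ring. }
    assert (Hp : 0 < q ^ (i + j + k)) by (apply pow_lt; exact Hq).
    assert (Hfact : INR (fact i) * INR (fact j) * INR (fact k)
      <= INR (fact (i + j + k + 0))).
    { rewrite <- !mult_INR; apply le_INR; rewrite Nat.add_0_r.
      pose proof (fact_mul_le i j); pose proof (fact_mul_le (i + j) k); nia. }
    assert (H0 : 0 <= INR (fact i) * INR (fact j) * INR (fact k))
      by (repeat apply Rmult_le_pos; apply pos_INR).
    unfold c; rewrite Rabs_mult, (Rabs_pos_eq _ H0).
    rewrite <- !pow_add, pow_inv.
    apply Rmult_le_reg_r with (q ^ (i + j + k)); [exact Hp|].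
    replace (/ q ^ (i + j + k) * (M * INR (fact (i + j + k + 0)))
      * q ^ (i + j + k)) with (M * INR (fact (i + j + k + 0)))
      by (field; lra).
    assert (0 <= Rabs (a i j k) * q ^ (i + j + k))
      by (apply Rmult_le_pos; [apply Rabs_pos|lra]).
    rewrite Rmult_assoc, (Rmult_comm M).
    apply Rmult_le_compat; assumption.
  - intros [[t' x'] y'] Hn; unfold near_pt, near in Hn; simpl in Hn.
    unfold jet_fun; simpl.
    pose proof (Rabs_pos (t' - t)); pose proof (Rabs_pos (x' - x));
      pose proof (Rabs_pos (y' - y)).
    (* With weight 1 / q, nearness keeps the increments below q / 4, well inside the domain of the
       power series. *)
    assert (Hs : Rabs (t' - t) + Rabs (x' - x) + Rabs (y' - y) < r).
    { apply (Rmult_lt_compat_l q) in Hn; [|exact Hq].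
      replace (q * (4 * / q * (Rabs (t' - t) + Rabs (x' - x) + Rabs (y' - y))))
        with (4 * (Rabs (t' - t) + Rabs (x' - x) + Rabs (y' - y))) in Hn
        by (field; lra).
      unfold q in Hn; lra. }
    destruct (H (t' - t) (x' - x) (y' - y)) as [_ Hser]; try lra.
    replace (t + (t' - t)) with t' in Hser by ring.
    replace (x + (x' - x)) with x' in Hser by ring.
    replace (y + (y' - y)) with y' in Hser by ring.
    symmetry; apply is_series_unique.
    eapply is_series_ext; [|exact Hser].
    intros n; simpl; rewrite hom_sum_degree; apply sum_degree_ext.
    intros i j k; unfold c; field.
    repeat split; apply INR_fact_neq_0.
Qed.

(** * Fixed points of causal operators on jets *)

Lemma jmul_local c c' d d' i j k :
  (forall i' j' k', (i' <= i)%nat -> (j' <= j)%nat -> (k' <= k)%nat ->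
    c i' j' k' = c' i' j' k') ->
  (forall i' j' k', (i' <= i)%nat -> (j' <= j)%nat -> (k' <= k)%nat ->
    d i' j' k' = d' i' j' k') ->
  (c * d)%jet i j k = (c' * d')%jet i j k.
Proof.
  revert c c' d d'.
  apply (jet_ind (fun i j k => forall c c' d d' : jet,
    (forall i' j' k', (i' <= i)%nat -> (j' <= j)%nat -> (k' <= k)%nat ->
      c i' j' k' = c' i' j' k') ->
    (forall i' j' k', (i' <= i)%nat -> (j' <= j)%nat -> (k' <= k)%nat ->
      d i' j' k' = d' i' j' k') ->
    (c * d)%jet i j k = (c' * d')%jet i j k)); clear i j k.
  - intros c c' d d' Hc Hd; rewrite !jmul_0, Hc, Hd by lia; reflexivity.
  - intros i j k IH c c' d d' Hc Hd; rewrite !jmul_St.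
    f_equal; apply IH; intros; unfold jdt; try apply Hc; try apply Hd; lia.
  - intros i j k IH c c' d d' Hc Hd; rewrite !jmul_S1.
    f_equal; apply IH; intros; unfold jd1; try apply Hc; try apply Hd; lia.
  - intros i j k IH c c' d d' Hc Hd; rewrite !jmul_S2.
    f_equal; apply IH; intros; unfold jd2; try apply Hc; try apply Hd; lia.
Qed.

(* A factor without constant term delays the dependence on the other factor by
   one degree. *)
Lemma jmul_local_strict c d d' i j k :
  c O O O = 0 ->
  (forall i' j' k', (i' + j' + k' < i + j + k)%nat ->
    d i' j' k' = d' i' j' k') ->
  (c * d)%jet i j k = (c * d')%jet i j k.
Proof.
  revert c d d'.
  apply (jet_ind (fun i j k => forall c d d' : jet, c O O O = 0 ->
    (forall i' j' k', (i' + j' + k' < i + j + k)%nat ->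
      d i' j' k' = d' i' j' k') ->
    (c * d)%jet i j k = (c * d')%jet i j k)); clear i j k.
  - intros c d d' Hc _; rewrite !jmul_0, Hc; ring.
  - intros i j k IH c d d' Hc Hd; rewrite !jmul_St; f_equal.
    + apply jmul_local; intros; [reflexivity|apply Hd; lia].
    + apply IH; [exact Hc|]; intros; apply Hd; lia.
  - intros i j k IH c d d' Hc Hd; rewrite !jmul_S1; f_equal.
    + apply jmul_local; intros; [reflexivity|apply Hd; lia].
    + apply IH; [exact Hc|]; intros; apply Hd; lia.
  - intros i j k IH c d d' Hc Hd; rewrite !jmul_S2; f_equal.
    + apply jmul_local; intros; [reflexivity|apply Hd; lia].
    + apply IH; [exact Hc|]; intros; apply Hd; lia.
Qed.

(** Iteration from the zero jet: coefficients with [deg] below n no longer change after step n, and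
    the limit inherits the bound satisfied by every iterate. [deg] is a parameter because inverses
    are built by total degree and the evolution system by x1-degree. *)
Lemma jet_fixpoint {I : Type} (deg : nat -> nat -> nat -> nat)
    (T : (I -> jet) -> I -> jet) (bd : nat -> nat -> nat -> R) :
  (forall w w' i j k,
    (forall a i' j' k', (deg i' j' k' < deg i j k)%nat ->
      w a i' j' k' = w' a i' j' k') ->
    forall a, T w a i j k = T w' a i j k) ->
  (forall i j k, 0 <= bd i j k) ->
  (forall w, (forall a i j k, Rabs (w a i j k) <= bd i j k) ->
    forall a i j k, Rabs (T w a i j k) <= bd i j k) ->
  exists w, (forall a, w a = T w a) /\
    forall a i j k, Rabs (w a i j k) <= bd i j k.
Proof.
  intros HT Hbd0 Hbd.
  set (it := fix it n := match n with
    | O => fun _ : I => jconst 0 | S m => T (it m) end).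
  assert (Hit : forall n m m', (n <= m)%nat -> (n <= m')%nat ->
    forall a i j k, (deg i j k < n)%nat -> it m a i j k = it m' a i j k).
  { induction n as [|n IH]; intros m m' Hm Hm' a i j k Hd; [lia|].
    destruct m as [|m]; [lia|]; destruct m' as [|m']; [lia|].
    apply HT; intros a' i' j' k' Hd'; apply IH; lia. }
  exists (fun a i j k => it (S (deg i j k)) a i j k); split.
  - intros a; apply jet_ext; intros i j k.
    apply HT; intros a' i' j' k' Hd'; apply (Hit (S (deg i' j' k'))); lia.
  - assert (Hb : forall n a i j k, Rabs (it n a i j k) <= bd i j k).
    { induction n as [|n IH]; [|apply Hbd; exact IH].
      intros a [|i] [|j] [|k]; simpl; rewrite Rabs_R0; apply Hbd0. }
    intros a i j k; apply Hb.
Qed.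

(** * Majorants by [phi] *)

Definition maj (a b K : R) (c : jet) : Prop :=
  bounded_by a b (fun n => K * phi n) c.

Lemma maj_weaken a b K a' b' K' c :
  0 <= a <= a' -> 0 <= b <= b' -> 0 <= K <= K' ->
  maj a b K c -> maj a' b' K' c.
Proof.
  intros Ha Hb HK; apply bounded_by_weaken; auto; intros n;
    pose proof (phi_pos n); nra.
Qed.

Lemma maj_add a b K K' c d :
  maj a b K c -> maj a b K' d -> maj a b (K + K') (c + d)%jet.
Proof.
  intros Hc Hd i j k; pose proof (bounded_by_add _ _ _ _ _ _ Hc Hd i j k).
  simpl in *; lra.
Qed.

Lemma maj_sub a b K K' c d :
  maj a b K c -> maj a b K' d -> maj a b (K + K') (c - d)%jet.
Proof.
  intros Hc Hd i j k; pose proof (bounded_by_sub _ _ _ _ _ _ Hc Hd i j k).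
  simpl in *; lra.
Qed.

Lemma phi_0 : phi 0 = 1.
Proof. unfold phi; simpl; field. Qed.

Lemma maj_const a b r : 0 <= a -> 0 <= b -> maj a b (Rabs r) (jconst r).
Proof.
  intros Ha Hb; apply bounded_by_const; auto.
  - rewrite phi_0; lra.
  - intros n; apply Rmult_le_pos; [apply Rabs_pos|left; apply phi_pos].
Qed.

Lemma maj_mul a b K K' c d :
  0 <= a -> 0 <= b -> 0 <= K -> 0 <= K' ->
  maj a b K c -> maj a b K' d -> maj a b (8 * K * K') (c * d)%jet.
Proof.
  intros Ha Hb HK HK' Hc Hd i j k.
  eapply Rle_trans; [apply (bounded_by_mul _ _ _ _ _ _ Hc Hd)|].
  rewrite leibniz_scal_l, leibniz_scal_r.
  apply Rmult_le_compat_l.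
  - repeat apply Rmult_le_pos; apply pow_le; assumption.
  - pose proof (leibniz_phi (i + j + k)).
    pose proof (Rmult_le_pos _ _ HK HK').
    replace (8 * K * K' * phi (i + j + k))
      with (K * K' * (8 * phi (i + j + k))) by ring.
    rewrite <- Rmult_assoc; apply Rmult_le_compat_l; assumption.
Qed.

Lemma fact_phi n : INR (fact n) <= 4 ^ n * phi n.
Proof.
  unfold phi.
  assert (H : INR (S n) <= 2 ^ n).
  { induction n as [|n IH]; [simpl; lra|].
    rewrite S_INR; simpl pow.
    pose proof (pow_R1_Rle 2 n ltac:(lra)); lra. }
  assert (Hn : 0 < INR (S n)) by (apply lt_0_INR; lia).
  replace 4 with (2 * 2) by ring; rewrite Rpow_mult_distr.
  pose proof (INR_fact_lt_0 n).
  apply Rmult_le_reg_r with (INR (S n) ^ 2); [apply pow_lt; exact Hn|].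
  rewrite <- !Rmult_assoc.
  rewrite (Rmult_assoc _ (/ _)), Rinv_l, Rmult_1_r
    by (apply pow_nonzero; lra).
  rewrite Rmult_comm; apply Rmult_le_compat_r; nra.
Qed.

Lemma phi_fact n : phi n <= INR (fact n).
Proof.
  unfold phi; rewrite <- (Rmult_1_r (INR (fact n))) at 2.
  apply Rmult_le_compat_l; [apply pos_INR|].
  rewrite <- Rinv_1; apply Rinv_le_contravar; [lra|].
  apply pow_R1_Rle; rewrite S_INR; pose proof (pos_INR n); lra.
Qed.

(** The factor 8 is 2 times 4: the powers of 2 absorb the shift of the factorial, and 4^n >= (n +
    1)^2 pays for the passage from n! to [phi]. *)
Lemma maj_of_analytic R0 c :
  0 <= R0 -> analytic_jet R0 c ->
  exists K, 0 <= K /\ maj (8 * R0) (8 * R0) K c.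
Proof.
  intros HR Hc.
  destruct (analytic_jet_same_shift _ _ _ HR Hc Hc) as [K [l [HK [H _]]]].
  pose proof (pos_INR (fact l)) as Hl; pose proof (pow_le 2 l ltac:(lra)).
  exists (K * (INR (fact l) * 2 ^ l)).
  split; [apply Rmult_le_pos; [|apply Rmult_le_pos]; assumption|].
  intros i j k; eapply Rle_trans; [apply H|].
  set (n := (i + j + k)%nat).
  rewrite !Rpow_mult_distr.
  replace (8 ^ i * R0 ^ i * (8 ^ j * R0 ^ j) * (8 ^ k * R0 ^ k))
    with (R0 ^ i * R0 ^ j * R0 ^ k * 8 ^ n)
    by (unfold n; rewrite !pow_add; ring).
  rewrite (Rmult_assoc (R0 ^ i * R0 ^ j * R0 ^ k)).
  apply Rmult_le_compat_l.
  { repeat apply Rmult_le_pos; apply pow_le; assumption. }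
  replace (8 ^ n * (K * (INR (fact l) * 2 ^ l) * phi n))
    with (K * (INR (fact l) * (2 ^ n * 2 ^ l) * (4 ^ n * phi n)))
    by (replace 8 with (2 * 4) by ring; rewrite Rpow_mult_distr; ring).
  rewrite <- pow_add; apply Rmult_le_compat_l; [exact HK|].
  eapply Rle_trans; [apply fact_shift_bound|].
  apply Rmult_le_compat_l; [|apply fact_phi].
  apply Rmult_le_pos; [exact Hl|apply pow_le; lra].
Qed.

Lemma analytic_of_maj a b K c :
  0 <= a <= b -> 0 <= K -> maj a b K c -> analytic_jet b c.
Proof.
  intros Ha HK H; exists K, O.
  apply (bounded_by_weaken a b b b (fun n => K * phi n)); auto; try lra.
  - intros n; rewrite Nat.add_0_r; apply Rmult_le_compat_l;
      [exact HK|apply phi_fact].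
  - intros n; apply Rmult_le_pos; [exact HK|apply pos_INR].
Qed.

(** Raising the weight by a factor q divides the constant by at least q in every degree n >= 1, and
    the coefficient of degree 0 vanishes. The extra 1 in the witness keeps the weight positive when
    [a] is 0. *)
Lemma maj_small a K (c : jet) eps :
  0 <= a -> 0 <= K -> 0 < eps -> c O O O = 0 -> maj a a K c ->
  exists a', a <= a' /\ 0 < a' /\ maj a' a' eps c.
Proof.
  intros Ha HK Heps H0 Hc.
  set (q := 1 + K / eps).
  assert (Hq0 : 0 <= K / eps)
    by (apply Rmult_le_pos; [|left; apply Rinv_0_lt_compat]; assumption).
  assert (Hq : 1 <= q) by (unfold q; lra).
  assert (HKq : K <= eps * q)
    by (unfold q; apply Rle_trans with (eps + K); [lra|right; field; lra]).
  exists (a * q + 1); split; [nra|split; [nra|]].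
  assert (Hcq : maj (a * q) (a * q) eps c).
  { intros i j k; rewrite !Rpow_mult_distr.
    replace (a ^ i * q ^ i * (a ^ j * q ^ j) * (a ^ k * q ^ k))
      with (a ^ i * a ^ j * a ^ k * q ^ (i + j + k))
      by (rewrite !pow_add; ring).
    assert (Hm : 0 <= a ^ i * a ^ j * a ^ k)
      by (repeat apply Rmult_le_pos; apply pow_le; exact Ha).
    destruct (i + j + k)%nat as [|n] eqn:En.
    - replace i with O by lia; replace j with O by lia; replace k with O by lia.
      rewrite H0, Rabs_R0, phi_0; simpl; lra.
    - eapply Rle_trans; [apply Hc|].
      rewrite En, (Rmult_assoc (a ^ i * a ^ j * a ^ k)).
      apply Rmult_le_compat_l; [exact Hm|].
      pose proof (pow_R1_Rle q n Hq) as Hqn.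
      rewrite <- Rmult_assoc; apply Rmult_le_compat_r;
        [left; apply phi_pos|].
      simpl pow; rewrite (Rmult_comm _ eps), <- Rmult_assoc.
      apply Rle_trans with (eps * q * 1); [lra|].
      apply Rmult_le_compat_l; lra. }
  eapply maj_weaken; [| | |exact Hcq]; nra.
Qed.

(** Write c = c0 + d. The inverse is the fixed point of w = (1 - d w) / c0, which is causal in the
    total degree because [d] has no constant term. *)
Lemma jet_inverse R0 (c : jet) :
  0 < R0 -> analytic_jet R0 c -> c O O O <> 0 ->
  exists R1 e, R0 <= R1 /\ analytic_jet R1 e /\ (e * c)%jet = jconst 1.
Proof.
  intros HR Hc H0; set (c0 := c O O O).
  assert (Hc0 : 0 < Rabs c0) by (apply Rabs_pos_lt; exact H0).
  set (d := (c - jconst c0)%jet).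
  assert (Hd0 : d O O O = 0) by (unfold d, jsub, c0; simpl; ring).
  destruct (maj_of_analytic R0 d) as [K [HK Hd]]; [lra| |].
  { apply analytic_jet_sub; [lra|exact Hc|apply analytic_jet_const; lra]. }
  (* The 16 compensates the 8 of [maj_mul]: with K1 = 2 / |c0|, the jet 1 - d w has constant 1 + 8
     (|c0| / 16) K1 = 2, and 2 / |c0| is K1 again. *)
  destruct (maj_small (8 * R0) K d (Rabs c0 / 16)) as [a [Ha [Ha0 Hda]]];
    try assumption; [lra|apply Rdiv_lt_0_compat; lra|].
  set (K1 := 2 * / Rabs c0).
  assert (HK1 : 0 < K1)
    by (apply Rmult_lt_0_compat; [lra|apply Rinv_0_lt_compat; exact Hc0]).
  assert (Hw : forall i j k, 0 <= a ^ i * a ^ j * a ^ k)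
    by (intros; repeat apply Rmult_le_pos; apply pow_le; lra).
  destruct (jet_fixpoint (fun i j k => (i + j + k)%nat)
    (fun (w : unit -> jet) _ =>
      (jconst (/ c0) * (jconst 1 - d * w tt))%jet)
    (fun i j k => a ^ i * a ^ j * a ^ k * (K1 * phi (i + j + k))))
    as [w [Hfix Hbd]].
  - intros w w' i j k H [].
    rewrite !jmul_const_coef; f_equal; unfold jsub; f_equal.
    apply jmul_local_strict; [exact Hd0|]; intros; apply H; assumption.
  - intros i j k; pose proof (phi_pos (i + j + k)); specialize (Hw i j k).
    apply Rmult_le_pos; nra.
  - intros w H _ i j k.
    assert (Hm : maj a a (1 + K1 * (Rabs c0 / 2)) (jconst 1 - d * w tt)%jet).
    { replace (K1 * (Rabs c0 / 2)) with (8 * (Rabs c0 / 16) * K1) by field.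
      rewrite <- Rabs_R1 at 1; apply maj_sub; [apply maj_const; lra|].
      apply maj_mul; try assumption; try lra; exact (H tt). }
    rewrite jmul_const_coef, Rabs_mult, Rabs_inv.
    specialize (Hm i j k); cbv beta in Hm.
    replace (1 + K1 * (Rabs c0 / 2)) with 2 in Hm
      by (unfold K1; field; lra).
    eapply Rle_trans; [apply Rmult_le_compat_l; [|exact Hm]|].
    + left; apply Rinv_0_lt_compat; exact Hc0.
    + unfold K1; right; ring.
  - exists a, (w tt); split; [lra|split].
    + apply analytic_of_maj with a K1; [lra|lra|exact (Hbd tt)].
    + pose proof (Hfix tt) as H; simpl in H.
      assert (Hcd : c = (d + jconst c0)%jet)
        by (unfold d; ring).
      assert (Hc1 : (jconst c0 * jconst (/ c0))%jet = jconst 1).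
      { apply jet_ext; intros i j k; rewrite jmul_const_coef.
        destruct i, j, k; simpl; try ring; field; exact H0. }
      transitivity (d * w tt + jconst c0 * w tt)%jet; [rewrite Hcd; ring|].
      rewrite H at 2.
      transitivity (d * w tt
        + (jconst c0 * jconst (/ c0)) * (jconst 1 - d * w tt))%jet; [ring|].
      rewrite Hc1; ring.
Qed.

(** * The Cauchy-Kovalevskaya theorem *)

(* Operators whose value up to x1-degree [n] depends only on the arguments up
   to x1-degree [n], and that are bounded independently of the x1-weight. *)
Definition admissible {I : Type} (a : R) (F : (I -> jet) -> jet) : Prop :=
  (forall w w' n,
    (forall u i j k, (j <= n)%nat -> w u i j k = w' u i j k) ->
    forall i j k, (j <= n)%nat -> F w i j k = F w' i j k) /\
  (forall K, 0 <= K -> exists K', 0 <= K' /\ forall b w, a <= b ->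
    (forall u, maj a b K (w u)) -> maj a b K' (F w)).

Lemma admissible_var {I : Type} a (u : I) : admissible a (fun w => w u).
Proof. split; [auto|]; intros K HK; exists K; auto. Qed.

Lemma admissible_param {I : Type} a K c :
  0 <= a -> 0 <= K -> maj a a K c -> admissible a (fun _ : I -> jet => c).
Proof.
  intros Ha HK Hc; split; [auto|]; intros K0 _; exists K; split; [exact HK|].
  intros b w Hb _; eapply maj_weaken; [| | |exact Hc]; lra.
Qed.

Lemma admissible_const {I : Type} a r :
  0 <= a -> admissible a (fun _ : I -> jet => jconst r).
Proof.
  intros Ha; apply admissible_param with (Rabs r);
    auto using Rabs_pos, maj_const.
Qed.

Lemma admissible_add {I : Type} a (F G : (I -> jet) -> jet) :
  admissible a F -> admissible a G -> admissible a (fun w => F w + G w)%jet.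
Proof.
  intros [HF1 HF2] [HG1 HG2]; split.
  - intros w w' n H i j k Hj; unfold jadd; f_equal;
      [apply (HF1 w w' n)|apply (HG1 w w' n)]; assumption.
  - intros K HK; destruct (HF2 K HK) as [K1 [HK1 H1]],
      (HG2 K HK) as [K2 [HK2 H2]].
    exists (K1 + K2); split; [lra|]; intros; apply maj_add; auto.
Qed.

Lemma admissible_sub {I : Type} a (F G : (I -> jet) -> jet) :
  admissible a F -> admissible a G -> admissible a (fun w => F w - G w)%jet.
Proof.
  intros [HF1 HF2] [HG1 HG2]; split.
  - intros w w' n H i j k Hj; unfold jsub; f_equal;
      [apply (HF1 w w' n)|apply (HG1 w w' n)]; assumption.
  - intros K HK; destruct (HF2 K HK) as [K1 [HK1 H1]],
      (HG2 K HK) as [K2 [HK2 H2]].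
    exists (K1 + K2); split; [lra|]; intros; apply maj_sub; auto.
Qed.

Lemma admissible_mul {I : Type} a (F G : (I -> jet) -> jet) :
  0 <= a ->
  admissible a F -> admissible a G -> admissible a (fun w => F w * G w)%jet.
Proof.
  intros Ha [HF1 HF2] [HG1 HG2]; split.
  - intros w w' n H i j k Hj; apply jmul_local; intros;
      [apply (HF1 w w' n)|apply (HG1 w w' n)]; auto; lia.
  - intros K HK; destruct (HF2 K HK) as [K1 [HK1 H1]],
      (HG2 K HK) as [K2 [HK2 H2]].
    exists (8 * K1 * K2); split; [nra|].
    intros; apply maj_mul; auto; lra.
Qed.

Lemma uniform_bound {I : Type} (l : list I) (Pr : I -> R -> Prop) :
  (forall u K K', 0 <= K <= K' -> Pr u K -> Pr u K') ->
  (forall u, exists K, 0 <= K /\ Pr u K) ->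
  exists K, 0 <= K /\ forall u, In u l -> Pr u K.
Proof.
  intros Hm Hex; induction l as [|u l [K [HK IH]]].
  - exists 0; split; [lra|]; intros _ [].
  - destruct (Hex u) as [K' [HK0 HK']]; exists (Rmax K K').
    pose proof (Rmax_l K K'); pose proof (Rmax_r K K').
    split; [lra|]; intros v [<-|Hv]; [apply Hm with K'|apply Hm with K]; auto.
Qed.

Lemma phi_S n : phi n <= 4 * phi (S n).
Proof.
  unfold phi; rewrite fact_simpl, mult_INR, (S_INR (S n)).
  pose proof (INR_fact_lt_0 n).
  assert (Hx : 1 <= INR (S n)) by (rewrite S_INR; pose proof (pos_INR n); lra).
  set (x := INR (S n)) in *.
  replace (4 * (x * INR (fact n) * / (x + 1) ^ 2))
    with (INR (fact n) * (4 * x * / (x + 1) ^ 2)) by ring.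
  apply Rmult_le_compat_l; [lra|].
  apply Rmult_le_reg_r with (x ^ 2 * (x + 1) ^ 2).
  { apply Rmult_lt_0_compat; apply pow_lt; lra. }
  replace (/ x ^ 2 * (x ^ 2 * (x + 1) ^ 2)) with ((x + 1) ^ 2) by (field; lra).
  replace (4 * x * / (x + 1) ^ 2 * (x ^ 2 * (x + 1) ^ 2)) with (4 * x ^ 3)
    by (field; lra).
  nra.
Qed.

(** The antiderivative in x1 that vanishes on x1 = x01. As entries are derivatives, it is a shift
    without division; the gain 1 / b comes from the weight alone. *)
Definition jint (c : jet) : jet := fun i j k =>
  match j with O => 0 | S j' => c i j' k end.

(* The iteration preserves the majorant [K * phi] once the x1-weight [b] is large:
   integrating in x1 gains a factor 1 / b, while d_2 only costs a factor [a]. *)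
Theorem cauchy_kovalevskaya {I : Type} (l : list I) (a : R) (init : I -> R)
    (P Q : I -> (I -> jet) -> jet) :
  (forall u, In u l) -> 0 < a ->
  (forall u, admissible a (P u)) -> (forall u, admissible a (Q u)) ->
  exists b w, a <= b /\
    (forall u, analytic_jet b (w u)) /\
    (forall u, jd1 (w u) = (P u w + jd2 (Q u w))%jet) /\
    (forall u i k, w u i O k = jconst (init u) i O k).
Proof.
  intros Hl Ha HP HQ.
  destruct (uniform_bound l (fun u K => Rabs (init u) <= K)) as [K0 [HK0 Hi]].
  { intros; lra. }
  { intros u; exists (Rabs (init u)); split; [apply Rabs_pos|lra]. }
  (* The summand 1 makes [K] positive even if all initial values vanish; the choice of [b] divides
     by it. *)
  set (K := K0 + 1).
  assert (HB : forall F : I -> (I -> jet) -> jet,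
    (forall u, admissible a (F u)) -> exists K', 0 <= K' /\
    forall u b w, a <= b -> (forall v, maj a b K (w v)) -> maj a b K' (F u w)).
  { intros F HF.
    destruct (uniform_bound l (fun u K' => forall b w, a <= b ->
      (forall v, maj a b K (w v)) -> maj a b K' (F u w))) as [K' [HK' H]].
    - intros u K1 K2 HK12 H b w Hb Hw.
      apply (maj_weaken a b K1); auto; lra.
    - intros u; destruct (HF u) as [_ HF2]; apply HF2; unfold K; lra.
    - exists K'; auto. }
  destruct (HB P HP) as [KP [HKP HBP]]; destruct (HB Q HQ) as [KQ [HKQ HBQ]].
  (* [KP] and [KQ] hold for every weight b >= a, so choosing [b] after them is not circular. The
     choice gives 4 KP + a KQ <= K b, where the 4 comes from [phi_S]. *)
  set (b := a + (4 * KP + a * KQ) / K).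
  assert (HK : 0 < K) by (unfold K; lra).
  assert (Hb0 : 0 <= (4 * KP + a * KQ) / K)
    by (apply Rmult_le_pos; [nra|left; apply Rinv_0_lt_compat; exact HK]).
  assert (Hab : a <= b) by (unfold b; lra).
  assert (HbK : 4 * KP + a * KQ <= K * b).
  { unfold b; rewrite Rmult_plus_distr_l.
    replace (K * ((4 * KP + a * KQ) / K)) with (4 * KP + a * KQ)
      by (field; lra).
    nra. }
  (* Causality is measured by the x1-degree alone: the derivative d_2 brings the total degree back
     up to that of the coefficient being computed. *)
  destruct (jet_fixpoint (fun _ j _ => j)
    (fun (w : I -> jet) u =>
      (jconst (init u) + jint (P u w + jd2 (Q u w)))%jet)
    (fun i j k => a ^ i * b ^ j * a ^ k * (K * phi (i + j + k))))
    as [w [Hfix Hbd]].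
  - intros w w' i [|j] k H u; unfold jadd at 1 3; f_equal.
    unfold jint, jadd, jd2; f_equal;
      [apply (proj1 (HP u) w w' j)|apply (proj1 (HQ u) w w' j)];
      auto; intros; apply H; lia.
  - intros i j k; pose proof (phi_pos (i + j + k)).
    apply Rmult_le_pos; [|nra].
    repeat apply Rmult_le_pos; apply pow_le; lra.
  - intros w H u i j k.
    destruct j as [|j].
    + unfold jadd, jint; rewrite Rplus_0_r.
      assert (Hc : maj a b K (jconst (init u))).
      { apply (maj_weaken a b (Rabs (init u))); try lra.
        - split; [apply Rabs_pos|unfold K; specialize (Hi u (Hl u)); lra].
        - apply maj_const; lra. }
      apply Hc.
    + assert (E0 : jconst (init u) i (S j) k = 0) by (destruct i; reflexivity).
      unfold jadd at 1; rewrite E0, Rplus_0_l; unfold jint, jadd, jd2.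
      eapply Rle_trans; [apply Rabs_triang|].
      pose proof (HBP u b w Hab H i j k) as H1; cbv beta in H1.
      pose proof (HBQ u b w Hab H i j (S k)) as H2; cbv beta in H2.
      replace (i + j + S k)%nat with (S (i + j + k)) in H2 by lia.
      replace (i + S j + k)%nat with (S (i + j + k)) by lia.
      set (n := (i + j + k)%nat) in *.
      assert (Hm : 0 <= a ^ i * b ^ j * a ^ k)
        by (repeat apply Rmult_le_pos; apply pow_le; lra).
      set (m := a ^ i * b ^ j * a ^ k) in *.
      pose proof (phi_S n); pose proof (phi_pos (S n)).
      apply Rle_trans with (m * ((4 * KP + a * KQ) * phi (S n))).
      * simpl pow in H2.
        replace (a ^ i * b ^ j * (a * a ^ k) * (KQ * phi (S n)))
          with (m * (a * KQ * phi (S n))) in H2 by (unfold m; ring).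
        assert (m * (KP * phi n) <= m * (KP * (4 * phi (S n))))
          by (repeat apply Rmult_le_compat_l; assumption).
        lra.
      * replace (a ^ i * b ^ S j * a ^ k * (K * phi (S n)))
          with (m * (K * b * phi (S n))) by (unfold m; simpl; ring).
        apply Rmult_le_compat_l; [exact Hm|].
        apply Rmult_le_compat_r; lra.
  - exists b, w; split; [exact Hab|split; [|split]].
    + intros u; apply analytic_of_maj with a K; [lra|lra|exact (Hbd u)].
    + intros u; apply jet_ext; intros i j k.
      unfold jd1; rewrite (Hfix u); unfold jadd at 1; unfold jint.
      destruct i; simpl; ring.
    + intros u i k; rewrite (Hfix u); unfold jadd at 1; unfold jint; ring.
Qed.

(** * The Gauss-Codazzi system *)

(* The metric coefficients E = g_11, F = g_12, G = g_22, the derivatives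
   P = d_1 G, R = d_2 G, S = d_2 E, M = d_2 F, and Delta = 1 / det g. *)
Inductive unknown := UE | UF | UG | UP | UR | US | UM | UDelta.

Definition all_unknowns :=
  UE :: UF :: UG :: UP :: UR :: US :: UM :: UDelta :: nil.

(** The Euclidean metric, with d_1 G = 0. As E, F, G are constant on x1 = x01, the zeros for R, S, M
    agree there with the d_2 derivatives they stand for. *)
Definition initial_value (u : unknown) : R :=
  match u with UE | UG | UDelta => 1 | _ => 0 end.

Definition half : jet := jconst (/ 2).

Section System.

(* [eta] stands for 1 / N, [c1] and [c2] for the left-hand sides of the Codazzi
   equations. *)
Context (L M eta c1 c2 kappa : jet).

(* The Codazzi equations solved for Gamma_{1,11} = d_1 E / 2 and
   Gamma_{2,11} = d_1 F - d_2 E / 2. *)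
Definition gamma111 (w : unknown -> jet) : jet :=
  (eta * (M * w US - L * (w UM - half * w UP) - c1 * w UE + c2 * w UF))%jet.
Definition gamma211 (w : unknown -> jet) : jet :=
  (eta * (M * w UP - half * (L * w UR) - c1 * w UF + c2 * w UG))%jet.

Definition d1E (w : unknown -> jet) : jet := (gamma111 w + gamma111 w)%jet.
Definition d1F (w : unknown -> jet) : jet := (half * w US + gamma211 w)%jet.

Definition det_jet (w : unknown -> jet) : jet :=
  (w UE * w UG - w UF * w UF)%jet.

(* det g * g^{kl} (Gamma_{k,12} Gamma_{l,12} - Gamma_{k,11} Gamma_{l,22}) *)
Definition gauss_quadratic (E F G g111 g211 g112 g212 g122 g222 : jet) : jet :=
  (G * (g112 * g112 - g111 * g122)
   - F * (g112 * g212 + g112 * g212 - g111 * g222 - g211 * g122)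
   + E * (g212 * g212 - g211 * g222))%jet.

(** The Gauss equation solved for (d_1^2 G + d_2^2 E) / 2 - d_1 d_2 F: in these combinations of
    second derivatives the lowered curvature is linear, and the rest is quadratic in the lowered
    Christoffel symbols. *)
Definition gauss_rhs (w : unknown -> jet) : jet :=
  (w UDelta * gauss_quadratic (w UE) (w UF) (w UG) (gamma111 w) (gamma211 w)
     (half * w US) (half * w UP) (w UM - half * w UP) (half * w UR)
   - kappa * det_jet w)%jet.

(** In the equation for P, the term d_2^2 E has cancelled against the one inside d_2 d_1 F; the
    remainder of d_2 d_1 F is the flux [gamma211]. The equation for Delta is the derivative of a
    reciprocal, - Delta^2 d_1 (det g). *)
Definition rhs_algebraic (u : unknown) (w : unknown -> jet) : jet :=
  match u with
  | UE => d1E w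
  | UF => d1F w
  | UG => w UP
  | UP => (gauss_rhs w + gauss_rhs w)%jet
  | UR | US | UM => jconst 0
  | UDelta => (jconst (-1) * (w UDelta * w UDelta
      * (d1E w * w UG + w UE * w UP - (d1F w * w UF + d1F w * w UF))))%jet
  end.

(* These terms occur in the system under d_2. *)
Definition rhs_flux (u : unknown) (w : unknown -> jet) : jet :=
  match u with
  | UE | UF | UG | UDelta => jconst 0
  | UP => (gamma211 w + gamma211 w)%jet
  | UR => w UP
  | US => d1E w
  | UM => d1F w
  end.

End System.

Lemma jet_eq_of_jd1 c d :
  jd1 c = jd1 d -> (forall i k, c i O k = d i O k) -> c = d.
Proof.
  intros H H0; apply jet_ext; intros i [|j] k; [apply H0|].
  exact (f_equal (fun e : jet => e i j k) H).
Qed.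

(** The x1-coefficients of [c] are determined recursively by lower ones, which vanish. *)
Lemma jet_linear_ode c d :
  jd1 c = (d * c)%jet -> (forall i k, c i O k = 0) -> c = jconst 0.
Proof.
  intros H H0.
  assert (Hz : forall i j k, jconst 0 i j k = 0)
    by (intros [|i] [|j] [|k]; reflexivity).
  assert (Hn : forall n i j k, (j <= n)%nat -> c i j k = 0).
  { induction n as [|n IH]; intros i [|j] k Hj; try apply H0; [lia|].
    change (jd1 c i j k = 0); rewrite H.
    rewrite (jmul_local d d c (jconst 0)); [|reflexivity|].
    - replace (d * jconst 0)%jet with (jconst 0) by ring; apply Hz.
    - intros i' j' k' _ Hj' _; rewrite Hz; apply IH; lia. }
  apply jet_ext; intros i j k; rewrite Hz; apply (Hn j); lia.
Qed.

Lemma half_double c : (half * c + half * c)%jet = c.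
Proof.
  apply jet_ext; intros; unfold half, jadd; rewrite !jmul_const_coef; lra.
Qed.

(** The two relations for N times a lowered symbol are the Codazzi equations, the second with its
    sign reversed, contracted with the rows (E, F) and (F, G) of the metric. *)
Lemma gauss_codazzi_jets R0 (L M N : jet) :
  0 < R0 -> analytic_jet R0 L -> analytic_jet R0 M -> analytic_jet R0 N ->
  N O O O <> 0 ->
  let c1 := (jd1 N - jd2 M)%jet in
  let c2 := (jd1 M - jd2 L)%jet in
  exists R1 (E F G Delta : jet), R0 <= R1 /\
    analytic_jet R1 E /\ analytic_jet R1 F /\ analytic_jet R1 G /\
    analytic_jet R1 Delta /\
    E O O O = 1 /\ F O O O = 0 /\ G O O O = 1 /\
    (Delta * (E * G - F * F))%jet = jconst 1 /\
    let g111 := (half * jd1 E)%jet in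
    let g211 := (jd1 F - half * jd2 E)%jet in
    let g112 := (half * jd2 E)%jet in
    let g212 := (half * jd1 G)%jet in
    let g122 := (jd2 F - half * jd1 G)%jet in
    let g222 := (half * jd2 G)%jet in
    (N * g111 = M * (g112 + g112) - L * g122 - c1 * E + c2 * F)%jet /\
    (N * g211 = M * (g212 + g212) - L * g222 - c1 * F + c2 * G)%jet /\
    (half * jd1 (jd1 G) + half * jd2 (jd2 E) - jd2 (jd1 F)
     = Delta * gauss_quadratic E F G g111 g211 g112 g212 g122 g222
       - (L * N - M * M) * (E * G - F * F))%jet.
Proof.
  intros HR HL HM HN HN0 c1 c2.
  destruct (jet_inverse R0 N HR HN HN0) as [R1 [eta [HR1 [Heta HetaN]]]].
  set (kappa := (L * N - M * M)%jet).
  assert (HR1' : 0 <= R0 <= R1) by lra.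
  apply (analytic_jet_weaken _ _ _ HR1') in HL, HM, HN.
  assert (Hc1 : analytic_jet R1 c1) by
    (apply analytic_jet_sub; [lra|apply analytic_jet_jd; exact HN
                             |apply analytic_jet_jd; exact HM]).
  assert (Hc2 : analytic_jet R1 c2) by
    (apply analytic_jet_sub; [lra|apply analytic_jet_jd; exact HM
                             |apply analytic_jet_jd; exact HL]).
  assert (Hkappa : analytic_jet R1 kappa) by
    (apply analytic_jet_sub; [lra| |]; apply analytic_jet_mul; assumption).
  assert (Ha : 0 < 8 * R1) by lra.
  assert (Hadm : forall c, analytic_jet R1 c ->
    admissible (8 * R1) (fun _ : unknown -> jet => c)).
  { intros c Hc; destruct (maj_of_analytic R1 c) as [K [HK Hmaj]]; [lra|auto|].
    apply admissible_param with K; auto; lra. }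
  assert (Hvar : forall u : unknown, admissible (8 * R1) (fun w => w u))
    by (intros; apply admissible_var).
  assert (Hconst : forall r,
    admissible (8 * R1) (fun _ : unknown -> jet => jconst r))
    by (intros; apply admissible_const; lra).
  assert (Hhalf : admissible (8 * R1) (fun _ : unknown -> jet => half))
    by apply Hconst.
  assert (Hmul : forall F G : (unknown -> jet) -> jet,
    admissible (8 * R1) F -> admissible (8 * R1) G ->
    admissible (8 * R1) (fun w => F w * G w)%jet)
    by (intros; apply admissible_mul; auto; lra).
  apply Hadm in HL, HM, Heta, Hc1, Hc2, Hkappa.
  assert (H111 : admissible (8 * R1) (gamma111 L M eta c1 c2))
    by (unfold gamma111; repeat first [assumption | apply Hvar | apply Hmul
      | apply admissible_sub | apply admissible_add]).
  assert (H211 : admissible (8 * R1) (gamma211 L M eta c1 c2))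
    by (unfold gamma211; repeat first [assumption | apply Hvar | apply Hmul
      | apply admissible_sub | apply admissible_add]).
  destruct (cauchy_kovalevskaya all_unknowns (8 * R1) initial_value
    (rhs_algebraic L M eta c1 c2 kappa) (rhs_flux L M eta c1 c2))
    as [b [w [Hb [Hw [Hd1 H0]]]]].
  - intros []; simpl; tauto.
  - exact Ha.
  - intros []; unfold rhs_algebraic, gauss_rhs, gauss_quadratic, d1E, d1F,
      det_jet;
    repeat first [assumption | apply Hvar | apply Hconst | apply Hmul
      | apply admissible_sub | apply admissible_add].
  - intros []; unfold rhs_flux, d1E, d1F;
    repeat first [assumption | apply Hvar | apply Hconst | apply Hmul
      | apply admissible_sub | apply admissible_add].
  - assert (Hz2 : jd2 (jconst 0) = jconst 0) by apply jd_const.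
    assert (HE : jd1 (w UE) = d1E L M eta c1 c2 w)
      by (rewrite Hd1; simpl; rewrite Hz2; ring).
    assert (HF : jd1 (w UF) = d1F L M eta c1 c2 w)
      by (rewrite Hd1; simpl; rewrite Hz2; ring).
    assert (HG : jd1 (w UG) = w UP) by (rewrite Hd1; simpl; rewrite Hz2; ring).
    assert (HP : jd1 (w UP) = (gauss_rhs L M eta c1 c2 kappa w
      + gauss_rhs L M eta c1 c2 kappa w + (jd2 (gamma211 L M eta c1 c2 w)
      + jd2 (gamma211 L M eta c1 c2 w)))%jet) by exact (Hd1 UP).
    (* Propagation of the constraints: both sides have the same x1-derivative by the choice of
       fluxes, and both vanish on x1 = x01 because the initial values are constant. *)
    assert (Hconstr : forall u v, jd1 (w u) = jd2 (jd1 (w v)) ->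
      initial_value u = 0 -> w u = jd2 (w v)).
    { intros u v Huv Hu; apply jet_eq_of_jd1; [exact Huv|].
      intros i k; rewrite H0, Hu; change (jd2 (w v) i O k) with (w v i O (S k)).
      rewrite H0; destruct i, k; reflexivity. }
    assert (HRG : w UR = jd2 (w UG))
      by (apply Hconstr; [rewrite HG, Hd1; simpl; ring|reflexivity]).
    assert (HSE : w US = jd2 (w UE))
      by (apply Hconstr; [rewrite HE, Hd1; simpl; ring|reflexivity]).
    assert (HMF : w UM = jd2 (w UF))
      by (apply Hconstr; [rewrite HF, Hd1; simpl; ring|reflexivity]).
    assert (Hdet : (w UDelta * det_jet w)%jet = jconst 1).
    (* The defect c = Delta det g - 1 vanishes on x1 = x01 and satisfies d_1 c = - Delta (d_1 det g)
       c. *)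
    { set (c := (w UDelta * det_jet w - jconst 1)%jet).
      assert (Hc : c = jconst 0).
      { apply jet_linear_ode with (jopp (w UDelta * (d1E L M eta c1 c2 w * w UG
          + w UE * w UP - (d1F L M eta c1 c2 w * w UF
          + d1F L M eta c1 c2 w * w UF)))%jet).
        - assert (Hsub : forall x y, jd1 (x - y)%jet = (jd1 x - jd1 y)%jet)
            by reflexivity.
          assert (Hm : forall x y,
            jd1 (x * y)%jet = (jd1 x * y + x * jd1 y)%jet) by apply jd_mul.
          assert (HD : jd1 (w UDelta) = _) by exact (Hd1 UDelta).
          simpl in HD; rewrite Hz2 in HD.
          unfold c, det_jet; rewrite !Hsub, !Hm, !Hsub, !Hm, HE, HF, HG, HD.
          rewrite (proj1 (proj2 (jd_const 1))).
          replace (jconst (-1)) with (jopp (jconst 1)); [ring|].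
          apply jet_ext; intros [|i] [|j] [|k]; unfold jopp; simpl; ring.
        - intros i k; unfold c, det_jet, jsub at 1.
          rewrite (jmul_local _ (jconst 1) _ (jconst 1)).
          + replace (jconst 1 * jconst 1)%jet with (jconst 1) by ring; ring.
          + intros i' j' k' _ Hj _; replace j' with O by lia; apply H0.
          + intros i' j' k' _ Hj _; replace j' with O by lia.
            transitivity ((jconst 1 * jconst 1 - jconst 0 * jconst 0)%jet
              i' O k');
              [|replace (jconst 1 * jconst 1 - jconst 0 * jconst 0)%jet
                 with (jconst 1) by ring; reflexivity].
            unfold jsub; f_equal; apply jmul_local; intros i'' j'' k'' _ Hj' _;
              replace j'' with O by lia; apply H0. }
      transitivity (c + jconst 1)%jet; [unfold c; ring|].
      rewrite Hc; ring. }
    exists b, (w UE), (w UF), (w UG), (w UDelta).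
    split; [lra|]; do 4 (split; [apply Hw|]).
    do 3 (split; [rewrite H0; reflexivity|]); split; [exact Hdet|].
    assert (H111' : (half * jd1 (w UE))%jet = gamma111 L M eta c1 c2 w).
    { rewrite HE; unfold d1E.
      rewrite <- (half_double (gamma111 _ _ _ _ _ w)) at 3.
      ring. }
    assert (H211' : (jd1 (w UF) - half * jd2 (w UE))%jet
      = gamma211 L M eta c1 c2 w) by (rewrite HF, <- HSE; unfold d1F; ring).
    cbv zeta; rewrite H111', H211'.
    split; [|split].
    + unfold gamma111; rewrite <- HSE, <- HMF, HG.
      transitivity ((eta * N) * (M * w US - L * (w UM - half * w UP)
        - c1 * w UE + c2 * w UF))%jet; [ring|].
      rewrite HetaN, half_double; ring.
    + unfold gamma211; rewrite HG, <- HRG.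
      transitivity ((eta * N) * (M * w UP - half * (L * w UR)
        - c1 * w UF + c2 * w UG))%jet; [ring|].
      rewrite HetaN, half_double; ring.
    + rewrite HG, HP, HF, <- HSE, <- HMF, <- HRG.
      unfold d1F.
      change (jd2 (half * w US + gamma211 L M eta c1 c2 w)%jet)
        with (jd2 (half * w US) + jd2 (gamma211 L M eta c1 c2 w))%jet.
      unfold half at 3; rewrite (proj2 (proj2 (jd_scal (/ 2) (w US)))).
      fold half; set (B := jd2 (gamma211 _ _ _ _ _ w)).
      set (q := gauss_rhs L M eta c1 c2 kappa w).
      transitivity (half * q + half * q + (half * B + half * B) - B)%jet;
        [ring|].
      rewrite !half_double; unfold q, gauss_rhs, det_jet; ring.
Qed.

(** * Curvature of metrics given by jets *)

Definition inv_jet (g : idx -> idx -> jet) (Delta : jet) (k l : idx) : jet :=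
  (match k, l with
   | X1, X1 => g X2 X2
   | X1, X2 => - g X1 X2
   | X2, X1 => - g X2 X1
   | X2, X2 => g X1 X1
   end * Delta)%jet.

Definition christoffel_jet (g : idx -> idx -> jet) (Delta : jet)
    (k i j : idx) : jet :=
  (half * (inv_jet g Delta k X1
           * (jd i (g j X1) + jd j (g i X1) - jd X1 (g i j))
         + inv_jet g Delta k X2
           * (jd i (g j X2) + jd j (g i X2) - jd X2 (g i j))))%jet.

Definition riemann_jet (g : idx -> idx -> jet) (Delta : jet)
    (l i j k : idx) : jet :=
  let Gamma := christoffel_jet g Delta in
  (jd i (Gamma l j k) - jd j (Gamma l i k)
   + ((Gamma X1 j k * Gamma l i X1 - Gamma X1 i k * Gamma l j X1)
      + (Gamma X2 j k * Gamma l i X2 - Gamma X2 i k * Gamma l j X2)))%jet.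

Lemma expands_eq p0 R0 f g c p :
  expands p0 R0 f c -> expands p0 R0 g c -> near_pt R0 p0 p -> f p = g p.
Proof. intros [_ Hf] [_ Hg] Hp; rewrite Hf, Hg by exact Hp; reflexivity. Qed.

Section MetricJets.

Context (p0 : R * R * R) (R0 : R) (HR : 0 < R0).
Context (g : tensor2) (gj : idx -> idx -> jet) (Delta : jet).
Context (Hg : forall i j, expands p0 R0 (g i j) (gj i j)).
Context (HDelta : analytic_jet R0 Delta).
Context (Hdet : (Delta * (gj X1 X1 * gj X2 X2 - gj X1 X2 * gj X2 X1))%jet
  = jconst 1).

Lemma expands_metric_det :
  expands p0 R0 (metric_det g)
    (gj X1 X1 * gj X2 X2 - gj X1 X2 * gj X2 X1)%jet.
Proof.
  unfold metric_det; apply expands_sub; auto; apply expands_mul; auto.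
Qed.

Lemma expands_metric_inv k l :
  expands p0 R0 (metric_inv g k l) (inv_jet gj Delta k l).
Proof.
  destruct k, l; unfold metric_inv, inv_jet;
    (eapply expands_div; [exact HR| |exact expands_metric_det| |]);
    auto; apply expands_opp; auto.
Qed.

Lemma expands_christoffel k i j :
  expands p0 R0 (christoffel g k i j) (christoffel_jet gj Delta k i j).
Proof.
  unfold christoffel, christoffel_jet, sum_idx.
  apply expands_mul; [exact HR|apply expands_const; exact HR|].
  apply expands_add; [exact HR| |];
    (apply expands_mul; [exact HR|apply expands_metric_inv|]);
    (apply expands_sub; [exact HR| |apply expands_D; auto]);
    apply expands_add; auto; apply expands_D; auto.
Qed.

Lemma expands_riemann l i j k :
  expands p0 R0 (riemann g l i j k) (riemann_jet gj Delta l i j k).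
Proof.
  unfold riemann, riemann_jet, sum_idx.
  pose proof expands_christoffel.
  apply expands_add; [exact HR| |].
  - apply expands_sub; [exact HR| |]; apply expands_D; auto.
  - apply expands_add; [exact HR| |];
      (apply expands_sub; [exact HR| |]); apply expands_mul; auto.
Qed.

Lemma expands_gauss_curvature :
  expands p0 R0 (gauss_curvature g)
    ((gj X1 X1 * riemann_jet gj Delta X1 X1 X2 X2
      + gj X1 X2 * riemann_jet gj Delta X2 X1 X2 X2) * Delta)%jet.
Proof.
  pose proof expands_riemann.
  unfold gauss_curvature, sum_idx; eapply expands_div;
    [exact HR| |exact expands_metric_det|exact HDelta|exact Hdet].
  apply expands_add; [exact HR| |]; apply expands_mul; auto.
Qed.

End MetricJets.

Definition metric_jet (E F G : jet) (i j : idx) : jet :=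
  match i, j with X1, X1 => E | X2, X2 => G | _, _ => F end.

(** Pure algebra: Delta times the adjugate matrix takes the place of the inverse metric and raises
    the first index. *)
Lemma christoffel_jet_lowered E F G Delta :
  let Gamma := christoffel_jet (metric_jet E F G) Delta in
  let g111 := (half * jd1 E)%jet in
  let g211 := (jd1 F - half * jd2 E)%jet in
  let g112 := (half * jd2 E)%jet in
  let g212 := (half * jd1 G)%jet in
  let g122 := (jd2 F - half * jd1 G)%jet in
  let g222 := (half * jd2 G)%jet in
  Gamma X1 X1 X1 = (Delta * (G * g111 - F * g211))%jet /\
  Gamma X2 X1 X1 = (Delta * (E * g211 - F * g111))%jet /\
  Gamma X1 X1 X2 = (Delta * (G * g112 - F * g212))%jet /\
  Gamma X2 X1 X2 = (Delta * (E * g212 - F * g112))%jet /\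
  Gamma X1 X2 X1 = (Delta * (G * g112 - F * g212))%jet /\
  Gamma X2 X2 X1 = (Delta * (E * g212 - F * g112))%jet /\
  Gamma X1 X2 X2 = (Delta * (G * g122 - F * g222))%jet /\
  Gamma X2 X2 X2 = (Delta * (E * g222 - F * g122))%jet.
Proof.
  intros Gamma g111 g211 g112 g212 g122 g222.
  assert (H211 : g211 = (half * (jd1 F + jd1 F - jd2 E))%jet).
  { unfold g211; rewrite <- (half_double (jd1 F)) at 1; ring. }
  assert (H122 : g122 = (half * (jd2 F + jd2 F - jd1 G))%jet).
  { unfold g122; rewrite <- (half_double (jd2 F)) at 1; ring. }
  rewrite H211, H122.
  unfold Gamma, christoffel_jet, inv_jet, g111, g112, g212, g222.
  simpl metric_jet; simpl jd; repeat split; ring.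
Qed.

Lemma gauss_codazzi_of_jets E F G Delta L M N :
  let c1 := (jd1 N - jd2 M)%jet in
  let c2 := (jd1 M - jd2 L)%jet in
  let g111 := (half * jd1 E)%jet in
  let g211 := (jd1 F - half * jd2 E)%jet in
  let g112 := (half * jd2 E)%jet in
  let g212 := (half * jd1 G)%jet in
  let g122 := (jd2 F - half * jd1 G)%jet in
  let g222 := (half * jd2 G)%jet in
  (Delta * (E * G - F * F))%jet = jconst 1 ->
  (N * g111 = M * (g112 + g112) - L * g122 - c1 * E + c2 * F)%jet ->
  (N * g211 = M * (g212 + g212) - L * g222 - c1 * F + c2 * G)%jet ->
  (half * jd1 (jd1 G) + half * jd2 (jd2 E) - jd2 (jd1 F)
   = Delta * gauss_quadratic E F G g111 g211 g112 g212 g122 g222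
     - (L * N - M * M) * (E * G - F * F))%jet ->
  let g := metric_jet E F G in
  let Gamma := christoffel_jet g Delta in
  (jd1 N - jd2 M = - Gamma X1 X2 X2 * L + jconst 2 * Gamma X1 X1 X2 * M
     - Gamma X1 X1 X1 * N)%jet /\
  (jd1 M - jd2 L = Gamma X2 X2 X2 * L - jconst 2 * Gamma X2 X1 X2 * M
     + Gamma X2 X1 X1 * N)%jet /\
  (L * N - M * M = (E * riemann_jet g Delta X1 X1 X2 X2
     + F * riemann_jet g Delta X2 X1 X2 X2) * Delta)%jet.
Proof.
  intros c1 c2 g111 g211 g112 g212 g122 g222 Hdet H1 H2 HK g Gamma.
  pose proof (christoffel_jet_lowered E F G Delta) as HG; cbv zeta in HG.
  fold g Gamma g211 g122 g111 g112 g212 g222 in HG.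
  destruct HG as [G111 [G211 [G112 [G212 [G121 [G221 [G122 G222]]]]]]].
  assert (H2c : jconst 2 = (jconst 1 + jconst 1)%jet).
  { apply jet_ext; intros [|i] [|j] [|k]; unfold jadd; simpl; ring. }
  split; [|split].
  - fold c1; rewrite H2c, G122, G112, G111.
    (* Inserting Delta det g = 1 produces the adjugate combination of the two lowered equations,
       which isolates [c1]. *)
    transitivity (Delta * (E * G - F * F) * c1)%jet; [rewrite Hdet; ring|].
    transitivity (Delta * (- ((G * g122 - F * g222) * L)
      + (G * (g112 + g112) - F * (g212 + g212)) * M
      - (G * (N * g111) - F * (N * g211))))%jet; [rewrite H1, H2; ring|ring].
  - fold c2; rewrite H2c, G222, G212, G211.
    transitivity (Delta * (E * G - F * F) * c2)%jet; [rewrite Hdet; ring|].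
    transitivity (Delta * ((E * g222 - F * g122) * L
      - (E * (g212 + g212) - F * (g112 + g112)) * M
      + (E * (N * g211) - F * (N * g111))))%jet; [rewrite H1, H2; ring|ring].
  - assert (HL12 : (E * Gamma X1 X1 X2 + F * Gamma X2 X1 X2)%jet = g112).
    { rewrite G112, G212.
      transitivity (Delta * (E * G - F * F) * g112)%jet; [ring|].
      rewrite Hdet; ring. }
    assert (HL22 : (E * Gamma X1 X2 X2 + F * Gamma X2 X2 X2)%jet = g122).
    { rewrite G122, G222.
      transitivity (Delta * (E * G - F * F) * g122)%jet; [ring|].
      rewrite Hdet; ring. }
    assert (HL11 : (E * Gamma X1 X1 X1 + F * Gamma X2 X1 X1)%jet = g111).
    { rewrite G111, G211.
      transitivity (Delta * (E * G - F * F) * g111)%jet; [ring|].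
      rewrite Hdet; ring. }
    (* Differentiating the lowered symbols avoids differentiating the inverse
       metric. *)
    assert (HD1 : (jd1 E * Gamma X1 X2 X2 + E * jd1 (Gamma X1 X2 X2)
      + (jd1 F * Gamma X2 X2 X2 + F * jd1 (Gamma X2 X2 X2)))%jet = jd1 g122).
    { rewrite <- HL22.
      change (jd1 (?a + ?b)%jet) with (jd1 a + jd1 b)%jet.
      rewrite !(proj1 (proj2 (jd_mul _ _))); reflexivity. }
    assert (HD2 : (jd2 E * Gamma X1 X1 X2 + E * jd2 (Gamma X1 X1 X2)
      + (jd2 F * Gamma X2 X1 X2 + F * jd2 (Gamma X2 X1 X2)))%jet = jd2 g112).
    { rewrite <- HL12.
      change (jd2 (?a + ?b)%jet) with (jd2 a + jd2 b)%jet.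
      rewrite !(proj2 (proj2 (jd_mul _ _))); reflexivity. }
    assert (Hg122 : jd1 g122 = (jd2 (jd1 F) - half * jd1 (jd1 G))%jet).
    { unfold g122.
      change (jd1 (?a - ?b)%jet) with (jd1 a - jd1 b)%jet.
      unfold half; rewrite (proj1 (proj2 (jd_scal _ _))); reflexivity. }
    assert (Hg112 : jd2 g112 = (half * jd2 (jd2 E))%jet)
      by (unfold g112, half; apply jd_scal).
    (* Metric compatibility: d_i g_jk is the sum of Gamma_{j,ik} and Gamma_{k,ij}. *)
    assert (HE1 : jd1 E = (g111 + g111)%jet) by (symmetry; apply half_double).
    assert (HE2 : jd2 E = (g112 + g112)%jet) by (symmetry; apply half_double).
    assert (HF1 : jd1 F = (g112 + g211)%jet) by (unfold g112, g211; ring).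
    assert (HF2 : jd2 F = (g122 + g212)%jet) by (unfold g122, g212; ring).
    (* The curvature with its upper index lowered. Derivatives of the lowered symbols replace those
       of the raised ones, at the price of products of first derivatives of the metric with raised
       symbols. *)
    transitivity ((jd1 g122 - jd2 g112
      - (jd1 E * Gamma X1 X2 X2 + jd1 F * Gamma X2 X2 X2)
      + (jd2 E * Gamma X1 X1 X2 + jd2 F * Gamma X2 X1 X2)
      + (Gamma X1 X2 X2 * g111 + Gamma X2 X2 X2 * g112
         - Gamma X1 X1 X2 * g112 - Gamma X2 X1 X2 * g122)) * Delta)%jet.
    + rewrite HE1, HE2, HF1, HF2, Hg122, Hg112, G122, G222, G112, G212.
      transitivity ((Delta * gauss_quadratic E F G g111 g211 g112 g212 g122 g222
        - (half * jd1 (jd1 G) + half * jd2 (jd2 E) - jd2 (jd1 F))) * Delta)%jet.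
      * rewrite HK.
        transitivity ((L * N - M * M) * (Delta * (E * G - F * F)))%jet;
          [rewrite Hdet|]; ring.
      * unfold gauss_quadratic; ring.
    + rewrite <- HD1, <- HD2.
      rewrite <- HL11, <- HL22, <- HL12.
      unfold riemann_jet; fold Gamma; cbn [jd].
      assert (S1 : Gamma X1 X2 X1 = Gamma X1 X1 X2) by congruence.
      assert (S2 : Gamma X2 X2 X1 = Gamma X2 X1 X2) by congruence.
      rewrite S1, S2; ring.
Qed.

(** * The evolving metric near the base point *)

Lemma jet_fun_base p0 c : jet_fun p0 c p0 = c O O O.
Proof.
  unfold jet_fun; rewrite !Rminus_diag; unfold eval.
  rewrite (Series_ext _ (fun n => hom n 0 0 0 (jconst (c O O O)))).
  - exact (eval_const _ 0 0 0).
  - assert (H0 : forall n d, dir (S n) 0 0 0 d = 0).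
    { intros n d; simpl; rewrite dir_jdir; ring. }
    intros [|n]; unfold hom; [reflexivity|].
    rewrite !H0; reflexivity.
Qed.

Lemma near_pt_base R0 p0 : near_pt R0 p0 p0.
Proof.
  unfold near_pt, near; rewrite !Rminus_diag, !Rabs_R0; lra.
Qed.

(** The diagonal part is at least 3 (a^2 + b^2) / 4 and the cross term 2 F a b at least - (a^2 +
    b^2) / 4, which leaves half of a^2 + b^2. *)
Lemma metric_pos (E F G a b : R) :
  Rabs (E - 1) < / 4 -> Rabs F < / 4 -> Rabs (G - 1) < / 4 ->
  (a <> 0 \/ b <> 0) ->
  0 < E * a * a + F * a * b + (F * b * a + G * b * b).
Proof.
  intros HE HF HG Hab.
  apply Rabs_def2 in HE, HF, HG.
  assert (Hs : 0 < a ^ 2 + b ^ 2).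
  { pose proof (pow2_ge_0 a); pose proof (pow2_ge_0 b).
    destruct Hab as [Ha|Hb];
      [pose proof (pow2_gt_0 a Ha)|pose proof (pow2_gt_0 b Hb)]; lra. }
  pose proof (pow2_ge_0 (a + b)); pose proof (pow2_ge_0 (a - b)).
  assert (0 <= (E - 3 / 4) * a ^ 2)
    by (apply Rmult_le_pos; [lra|apply pow2_ge_0]).
  assert (0 <= (G - 3 / 4) * b ^ 2)
    by (apply Rmult_le_pos; [lra|apply pow2_ge_0]).
  assert (0 <= (F + / 4) * (a + b) ^ 2)
    by (apply Rmult_le_pos; [lra|apply pow2_ge_0]).
  assert (0 <= (/ 4 - F) * (a - b) ^ 2)
    by (apply Rmult_le_pos; [lra|apply pow2_ge_0]).
  nra.
Qed.

Theorem corollary9p1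
    (U : R * R * R -> Prop) (u v T11 T12 T22 rho : field)
    (t0 x01 x02 tau : R)
    (hU : open U) (hU0 : U (t0, x01, x02))
    (hu : analytic_on U u) (hv : analytic_on U v)
    (hT11 : analytic_on U T11) (hT12 : analytic_on U T12)
    (hT22 : analytic_on U T22) (hrho : analytic_on U rho)
    (hbal : balance_laws U u v T11 T12 T22 rho)
    (htau : 0 < tau)
    (hpos : forall t x1 x2 : R, let p := (t, x1, x2) in
      U p -> t0 <= t < t0 + tau ->
      T11 p * T22 p - T12 p ^ 2 + 2 * rho p * u p * v p * T12 p
        - rho p * v p ^ 2 * T11 p - rho p * u p ^ 2 * T22 p > 0)
    (hM : let p0 := (t0, x01, x02) in T12 p0 - rho p0 * u p0 * v p0 <> 0) :
  exists (delta : posreal) (g : tensor2),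
    (* a product of a time interval and a spatial neighbourhood of x0 *)
    let W := ball (t0, x01, x02) delta in
    (forall p, W p -> U p) /\
    evolving_metric W g /\
    gauss_codazzi W g
      (fun p => rho p * v p ^ 2 - T22 p)
      (fun p => - (rho p * u p * v p) + T12 p)
      (fun p => rho p * u p ^ 2 - T11 p).
Proof.
  set (p0 := (t0, x01, x02)).
  destruct (expands_of_analytic u t0 x01 x02 (hu _ hU0)) as [Ru [cu [HRu Hu]]].
  destruct (expands_of_analytic v t0 x01 x02 (hv _ hU0)) as [Rv [cv [HRv Hv]]].
  destruct (expands_of_analytic T11 t0 x01 x02 (hT11 _ hU0))
    as [R11 [c11 [HR11 H11]]].
  destruct (expands_of_analytic T12 t0 x01 x02 (hT12 _ hU0))
    as [R12 [c12 [HR12 H12]]].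
  destruct (expands_of_analytic T22 t0 x01 x02 (hT22 _ hU0))
    as [R22 [c22 [HR22 H22]]].
  destruct (expands_of_analytic rho t0 x01 x02 (hrho _ hU0))
    as [Rr [cr [HRr Hr]]].
  fold p0 in Hu, Hv, H11, H12, H22, Hr.
  (* A larger weight means a smaller region, so the sum serves all six fields. *)
  set (R0 := Ru + Rv + R11 + R12 + R22 + Rr).
  assert (HR0 : 0 < R0) by (unfold R0; lra).
  apply expands_weaken with (R1 := R0) in Hu, Hv, H11, H12, H22, Hr;
    try (unfold R0; lra).
  set (Lf := fun p => rho p * v p ^ 2 - T22 p).
  set (Mf := fun p => - (rho p * u p * v p) + T12 p).
  set (Nf := fun p => rho p * u p ^ 2 - T11 p).
  set (L := (cr * (cv * cv) - c22)%jet).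
  set (M := (- (cr * cu * cv) + c12)%jet).
  set (N := (cr * (cu * cu) - c11)%jet).
  assert (HL : expands p0 R0 Lf L)
    by (apply expands_sub; auto; apply expands_mul; auto; apply expands_sqr;
        auto).
  assert (HM : expands p0 R0 Mf M)
    by (apply expands_add; auto; apply expands_opp; auto;
        repeat apply expands_mul; auto).
  assert (HN : expands p0 R0 Nf N)
    by (apply expands_sub; auto; apply expands_mul; auto; apply expands_sqr;
        auto).
  (* L N - M^2 > 0 at the base point: the line x1 = x01 is
     noncharacteristic. *)
  assert (HN0 : N O O O <> 0).
  { rewrite <- (jet_fun_base p0), <- (proj2 HN) by apply near_pt_base.
    intros H0; specialize (hpos t0 x01 x02 hU0 ltac:(lra)); cbv zeta in hpos.
    fold p0 in hpos.
    (* The terms rho^2 u^2 v^2 cancel, and L N - M^2 is exactly the expression in [hpos]. *)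
    assert (Lf p0 * Nf p0 - Mf p0 ^ 2 > 0)
      by (unfold Lf, Mf, Nf; nra).
    rewrite H0 in H; pose proof (pow2_ge_0 (Mf p0)); lra. }
  destruct (gauss_codazzi_jets R0 L M N HR0 (proj1 HL) (proj1 HM) (proj1 HN)
    HN0) as [R1 [E [F [G [Delta [HR1 [HE [HF [HG [HDelta [HE0 [HF0 [HG0
      [Hdet [H1 [H2 HK]]]]]]]]]]]]]]]].
  destruct (gauss_codazzi_of_jets E F G Delta L M N Hdet H1 H2 HK)
    as [Hcod1 [Hcod2 Hgauss]]; clear H1 H2 HK.
  assert (HR1' : 0 < R1) by lra.
  apply expands_weaken with (R1 := R1) in HL, HM, HN; try lra.
  set (gj := metric_jet E F G) in *.
  set (g := fun i j => jet_fun p0 (gj i j)).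
  assert (Hg : forall i j, expands p0 R1 (g i j) (gj i j))
    by (intros [] []; apply expands_jet_fun; assumption).
  assert (Hclose : forall c : jet, analytic_jet R1 c -> locally p0
    (fun p => Rabs (jet_fun p0 c p - c O O O) < / 4)).
  { intros c Hc.
    pose proof (expands_continuous p0 R1 _ c p0 HR1'
      (expands_jet_fun p0 R1 c Hc) (near_pt_base R1 p0)) as Hcont.
    rewrite <- (jet_fun_base p0 c).
    exact (proj1 (filterlim_locally _ _) Hcont (mkposreal (/ 4) ltac:(lra))). }
  assert (Hnear : locally p0 (near_pt R1 p0)).
  { destruct (near_pt_open p0 R1 t0 x01 x02 HR1' (near_pt_base R1 p0))
      as [eps Heps].
    exists eps; intros [[t x] y] Hb; apply ball_prod3 in Hb.
    apply Heps; apply Hb. }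
  (* The ball must lie in [U], in the region where the expansions hold, and where E, F, G differ
     from 1, 0, 1 by less than 1 / 4. *)
  destruct (filter_and _ _ (hU p0 hU0) (filter_and _ _ Hnear
    (filter_and _ _ (Hclose E HE) (filter_and _ _ (Hclose F HF)
      (Hclose G HG))))) as [delta Hdelta].
  exists delta, g; split; [|split; [split|]].
  - intros p Hp; apply Hdelta, Hp.
  - intros i j; apply expands_smooth with p0 R1 (gj i j); auto.
    intros p Hp; apply Hdelta, Hp.
  - intros p Hp; destruct (Hdelta p Hp) as [_ [_ [HpE [HpF HpG]]]].
    split; [intros [] []; reflexivity|].
    intros xi [i Hi]; rewrite HE0 in HpE; rewrite HG0 in HpG.
    rewrite HF0, Rminus_0_r in HpF.
    apply metric_pos; try assumption.
    destruct i; [left|right]; exact Hi.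
  - intros p Hp.
    assert (Hnp : near_pt R1 p0 p) by apply Hdelta, Hp.
    assert (HGam : forall k i j, expands p0 R1 (christoffel g k i j)
      (christoffel_jet gj Delta k i j))
      by (intros; apply expands_christoffel; assumption).
    assert (H2c : expands p0 R1 (fun _ => 2) (jconst 2))
      by (apply expands_const; assumption).
    split; [|split].
    (* Each equation holds because its two sides have equal jets, by [Hcod1], [Hcod2] and [Hgauss]
       respectively. *)
    + apply (expands_eq p0 R1 (fun p => Defs.D X1 Nf p - Defs.D X2 Mf p)
        (fun p => - christoffel g X1 X2 X2 p * Lf p
          + 2 * christoffel g X1 X1 X2 p * Mf p
          - christoffel g X1 X1 X1 p * Nf p) (jd1 N - jd2 M)%jet);
        [|rewrite Hcod1|exact Hnp].
      * apply expands_sub; [assumption| |];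
          [apply (expands_D _ _ X1)|apply (expands_D _ _ X2)]; assumption.
      * apply expands_sub; [assumption| |apply expands_mul; auto].
        apply expands_add; [assumption| |];
          repeat (apply expands_mul; auto); apply expands_opp; auto.
    + apply (expands_eq p0 R1 (fun p => Defs.D X1 Mf p - Defs.D X2 Lf p)
        (fun p => christoffel g X2 X2 X2 p * Lf p
          - 2 * christoffel g X2 X1 X2 p * Mf p
          + christoffel g X2 X1 X1 p * Nf p) (jd1 M - jd2 L)%jet);
        [|rewrite Hcod2|exact Hnp].
      * apply expands_sub; [assumption| |];
          [apply (expands_D _ _ X1)|apply (expands_D _ _ X2)]; assumption.
      * apply expands_add; [assumption| |apply expands_mul; auto].
        apply expands_sub; [assumption| |];
          repeat (apply expands_mul; auto).
    + apply (expands_eq p0 R1 (fun p => Lf p * Nf p - Mf p ^ 2)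
        (gauss_curvature g) (L * N - M * M)%jet); [|rewrite Hgauss|exact Hnp].
      * apply expands_sub; [assumption|apply expands_mul; auto
          |apply expands_sqr; auto].
      * exact (expands_gauss_curvature p0 R1 HR1' g gj Delta Hg HDelta Hdet).
Qed.
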